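(* Let $D'$ and $N'$ be coprime square-free positive integers such that $D'$ is the product of an odd number of primes, and let $m$ be an integer with $m\mid D'N'$, $m>1$ and $m\neq 3$. The following are equivalent. (1) There exist a definite quaternion algebra $B'$ over $\mathbf{Q}$ of discriminant $D'$, an Eichler order $\mathcal{O}'$ of level $N'$ in $B'$, and elements $\omega_1,\omega_2\in B'$ with $\omega_1^2=-3$, $\omega_2^2=-m$, and $\frac{1+\omega_1}{2}\in\mathcal{O}'$, $\omega_2\in\mathcal{O}'$. (2) Writing $D'=\prod_i p_i$ and $N'=\prod_j q_j$ as products of distinct primes: either $m=D'N'$, or $3\mid D'N'$ and $m=D'N'/3$; for every $i$, $p_i=3$ or $p_i\equiv 2\pmod 3$; and for every $j$, $q_j=3$ or $q_j\equiv 1\pmod 3$.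
   Context: The discriminant of a quaternion algebra $B$ over $\mathbf{Q}$ is the product of the finite primes at which $B$ is ramified; $B$ is definite if it is ramified at $\infty$. An Eichler order is an intersection of two maximal $\mathbf{Z}$-orders, and its level is its index in either of them; for square-free level $N'$ coprime to $D'$ these are the orders of reduced discriminant $D'N'$. *)

(* Defs.v *)
(* Mathematical Components with its classical layer (Analysis) for sets, choice
   and the reals. *)
From HB Require Import structures.
From mathcomp Require Import all_boot all_order all_algebra.
From mathcomp Require Import boolp classical_sets reals.
From mathcomp Require Import ring.

Set Implicit Arguments.
Unset Strict Implicit.
Unset Printing Implicit Defensive.

Set Warnings "-redundant-canonical-projection".

Import Order.TTheory GRing.Theory Num.Theory.
Local Open Scope ring_scope.

(* The p-adic integers as the inverse limit of the rings Z/p^n: the n-th term is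
   the canonical representative modulo p^n. The compatibility condition forces
   res n < p^n. *)
Record padic_int (p : nat) (p_pr : prime p) := PadicInt {
  padic_res :> nat -> nat;
  padic_compat : forall n, (padic_res n.+1 %% p ^ n)%N = padic_res n }.

Section PadicInt.
Variables (p : nat) (p_pr : prime p).
Local Notation Zp := (padic_int p_pr).
Implicit Types x y z : Zp.

HB.instance Definition _ := gen_eqMixin Zp.
HB.instance Definition _ := gen_choiceMixin Zp.

Lemma padic_ext x y : (forall n, x n = y n) -> x = y.
Proof.
case: x y => [x xP] [y yP] /= /funext exy; case: y / exy yP => yP.
by rewrite (Prop_irrelevance xP yP).
Qed.

Lemma padic_pexp_gt0 n : (0 < p ^ n)%N.
Proof. by rewrite expn_gt0 prime_gt0. Qed.

Lemma padic_res_lt x n : (x n < p ^ n)%N.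
Proof. by rewrite -padic_compat ltn_mod padic_pexp_gt0. Qed.

Lemma padic_mod x n : (x n %% p ^ n)%N = x n.
Proof. by rewrite modn_small ?padic_res_lt. Qed.

Fact padic_cst_compat (m n : nat) :
  ((m %% p ^ n.+1) %% p ^ n)%N = (m %% p ^ n)%N.
Proof. by rewrite modn_dvdm // dvdn_exp2l. Qed.

Fact padic_opp_compat x (n : nat) :
  (((p ^ n.+1 - x n.+1) %% p ^ n.+1) %% p ^ n)%N = ((p ^ n - x n) %% p ^ n)%N.
Proof.
rewrite padic_cst_compat; apply/eqP; rewrite -(eqn_modDr (x n.+1)).
rewrite subnK ?(ltnW (padic_res_lt _ _)) // -modnDmr padic_compat.
by rewrite subnK ?(ltnW (padic_res_lt _ _)) // expnS modnMl modnn.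
Qed.

Fact padic_add_compat x y (n : nat) :
  (((x n.+1 + y n.+1) %% p ^ n.+1) %% p ^ n)%N = ((x n + y n) %% p ^ n)%N.
Proof. by rewrite padic_cst_compat -modnDm !padic_compat. Qed.

Fact padic_mul_compat x y (n : nat) :
  (((x n.+1 * y n.+1) %% p ^ n.+1) %% p ^ n)%N = ((x n * y n) %% p ^ n)%N.
Proof. by rewrite padic_cst_compat -modnMm !padic_compat. Qed.

Definition padic_cst (m : nat) : Zp := PadicInt p_pr (padic_cst_compat m).
Definition padic_opp x : Zp := PadicInt p_pr (padic_opp_compat x).
Definition padic_add x y : Zp := PadicInt p_pr (padic_add_compat x y).
Definition padic_mul x y : Zp := PadicInt p_pr (padic_mul_compat x y).

Fact padic_addA : associative padic_add.
Proof. by move=> x y z; apply: padic_ext => n /=; rewrite modnDml modnDmr addnA. Qed.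

Fact padic_addC : commutative padic_add.
Proof. by move=> x y; apply: padic_ext => n /=; rewrite addnC. Qed.

Fact padic_add0 : left_id (padic_cst 0) padic_add.
Proof. by move=> x; apply: padic_ext => n /=; rewrite mod0n add0n padic_mod. Qed.

Fact padic_addN : left_inverse (padic_cst 0) padic_opp padic_add.
Proof.
move=> x; apply: padic_ext => n /=.
by rewrite modnDml subnK ?modnn ?mod0n // ltnW // padic_res_lt.
Qed.

HB.instance Definition _ :=
  GRing.isZmodule.Build Zp padic_addA padic_addC padic_add0 padic_addN.

Fact padic_mulA : associative padic_mul.
Proof. by move=> x y z; apply: padic_ext => n /=; rewrite modnMml modnMmr mulnA. Qed.

Fact padic_mulC : commutative padic_mul.
Proof. by move=> x y; apply: padic_ext => n /=; rewrite mulnC. Qed.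

Fact padic_mul1 : left_id (padic_cst 1) padic_mul.
Proof. by move=> x; apply: padic_ext => n /=; rewrite modnMml mul1n padic_mod. Qed.

Fact padic_mulDl : left_distributive padic_mul padic_add.
Proof.
by move=> x y z; apply: padic_ext => n /=; rewrite modnMml modnDml modnDmr mulnDl.
Qed.

Fact padic_1neq0 : padic_cst 1 != padic_cst 0.
Proof.
apply/eqP => /(congr1 (fun x : Zp => x 1%N)) /=.
by rewrite expn1 mod0n modn_small // prime_gt1.
Qed.

HB.instance Definition _ := GRing.Zmodule_isComNzRing.Build Zp
  padic_mulA padic_mulC padic_mul1 padic_mulDl padic_1neq0.

Definition padic_unit : {pred Zp} := fun x => `[< exists y, y * x = 1 >].
Definition padic_inv x : Zp :=
  if pselect (exists y, y * x = 1) is left ex then projT1 (cid ex) else x.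

Fact padic_mulV : {in padic_unit, left_inverse 1 padic_inv *%R}.
Proof.
move=> x /asboolP ex; rewrite /padic_inv; case: pselect => // ex'.
by case: (cid ex').
Qed.

Fact padic_unitP x y : y * x = 1 -> padic_unit x.
Proof. by move=> yx1; apply/asboolP; exists y. Qed.

Fact padic_inv_out : {in [predC padic_unit], padic_inv =1 id}.
Proof.
move=> x /negP nux; rewrite /padic_inv; case: pselect => // ex.
by case: nux; apply/asboolP.
Qed.

HB.instance Definition _ :=
  GRing.ComNzRing_hasMulInverse.Build Zp padic_mulV padic_unitP padic_inv_out.

Lemma padic_res_le x m n : (m <= n)%N -> (x n %% p ^ m)%N = x m.
Proof.
elim: n => [|n IHn]; first by rewrite leqn0 => /eqP ->; exact: padic_mod.
rewrite leq_eqVlt => /predU1P[-> | le_mn]; first exact: padic_mod.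
by rewrite -(modn_dvdm _ (dvdn_exp2l p (le_mn : m <= n)%N)) padic_compat IHn.
Qed.

Lemma padic_neq0 x : x != 0 -> exists n, x n != 0%N.
Proof.
move=> x0; apply: contrapT => /forallNP x_n; case/eqP: x0.
by apply: padic_ext => n /=; rewrite mod0n; apply/eqP/negPn/negP/(x_n n).
Qed.

Fact padic_mulf_eq0 : GRing.integral_domain_axiom Zp.
Proof.
move=> x y xy0; apply/norP => -[/padic_neq0[m xm] /padic_neq0[k yk]].
have := congr1 (fun z : Zp => z (m + k)%N) xy0; rewrite /= mod0n => /eqP.
have val_lt (z : Zp) i n : (i <= n)%N -> z i != 0%N ->
    (0 < z n)%N /\ (logn p (z n) < i)%N.
  move=> le_in zi; have zn : (0 < z n)%N.
    by case: posnP => // zn; rewrite -(padic_res_le z le_in) zn mod0n in zi.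
  split=> //; rewrite ltnNge -(pfactor_dvdn _ p_pr zn) /dvdn.
  by rewrite (padic_res_le z le_in).
have [x_gt0 lx] := val_lt x _ _ (leq_addr k m) xm.
have [y_gt0 ly] := val_lt y _ _ (leq_addl m k) yk.
rewrite -/(dvdn _ _) pfactor_dvdn ?muln_gt0 ?x_gt0 // lognM //.
by rewrite leqNgt -addnS leq_add // ltnW.
Qed.

HB.instance Definition _ :=
  GRing.ComUnitRing_isIntegral.Build Zp padic_mulf_eq0.

End PadicInt.

Definition padic (p : nat) (p_pr : prime p) : fieldType :=
  {fraction padic_int p_pr}.

(* The quaternion algebra (a, b / F) with basis 1, i, j, k, where i^2 = a,
   j^2 = b, k = i j = - j i. When a, b are nonzero and F has characteristic
   other than 2 these are, up to isomorphism, all the quaternion algebras over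
   F; the scalar extension of (a, b / F) to K is (a, b / K). *)
Record quat (F : fieldType) (a b : F) :=
  Quat { q_1 : F; q_i : F; q_j : F; q_k : F }.

Section Quat.
Variables (F : fieldType) (a b : F).
Local Notation B := (quat a b).
Local Notation Q := (@Quat F a b).
Implicit Types x y z : B.

Definition quat_to_tuple x := (q_1 x, q_i x, q_j x, q_k x).
Definition quat_of_tuple (t : F * F * F * F) : B :=
  let: (t1, ti, tj, tk) := t in Quat a b t1 ti tj tk.

Fact quat_to_tupleK : cancel quat_to_tuple quat_of_tuple.
Proof. by case. Qed.

HB.instance Definition _ := Choice.copy B (can_type quat_to_tupleK).

Definition quat_opp x := Q (- q_1 x) (- q_i x) (- q_j x) (- q_k x).
Definition quat_add x y :=
  Q (q_1 x + q_1 y) (q_i x + q_i y) (q_j x + q_j y) (q_k x + q_k y).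

Fact quat_addA : associative quat_add.
Proof. by case=> ? ? ? ? [? ? ? ?] [? ? ? ?]; rewrite /quat_add /= !addrA. Qed.

Fact quat_addC : commutative quat_add.
Proof. by case=> ? ? ? ? [? ? ? ?]; congr Quat; rewrite /= addrC. Qed.

Fact quat_add0 : left_id (Q 0 0 0 0) quat_add.
Proof. by case=> ? ? ? ?; rewrite /quat_add /= !add0r. Qed.

Fact quat_addN : left_inverse (Q 0 0 0 0) quat_opp quat_add.
Proof. by case=> ? ? ? ?; rewrite /quat_add /= !addNr. Qed.

HB.instance Definition _ :=
  GRing.isZmodule.Build B quat_addA quat_addC quat_add0 quat_addN.

Definition quat_mul x y :=
  Q (q_1 x * q_1 y + a * (q_i x * q_i y) + b * (q_j x * q_j y)
       - a * b * (q_k x * q_k y))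
    (q_1 x * q_i y + q_i x * q_1 y - b * (q_j x * q_k y) + b * (q_k x * q_j y))
    (q_1 x * q_j y + q_j x * q_1 y + a * (q_i x * q_k y) - a * (q_k x * q_i y))
    (q_1 x * q_k y + q_k x * q_1 y + q_i x * q_j y - q_j x * q_i y).

Fact quat_mulA : associative quat_mul.
Proof. by case=> ? ? ? ? [? ? ? ?] [? ? ? ?]; congr Quat => /=; ring. Qed.

Fact quat_mul1 : left_id (Q 1 0 0 0) quat_mul.
Proof. by case=> ? ? ? ?; congr Quat => /=; ring. Qed.

Fact quat_mulr1 : right_id (Q 1 0 0 0) quat_mul.
Proof. by case=> ? ? ? ?; congr Quat => /=; ring. Qed.

Fact quat_mulDl : left_distributive quat_mul +%R.
Proof. by case=> ? ? ? ? [? ? ? ?] [? ? ? ?]; congr Quat => /=; ring. Qed.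

Fact quat_mulDr : right_distributive quat_mul +%R.
Proof. by case=> ? ? ? ? [? ? ? ?] [? ? ? ?]; congr Quat => /=; ring. Qed.

Fact quat_1neq0 : Q 1 0 0 0 != 0.
Proof. by apply/eqP => -[/eqP]; rewrite oner_eq0. Qed.

HB.instance Definition _ := GRing.Zmodule_isNzRing.Build B
  quat_mulA quat_mul1 quat_mulr1 quat_mulDl quat_mulDr quat_1neq0.

Definition quat_scale (c : F) x := Q (c * q_1 x) (c * q_i x) (c * q_j x) (c * q_k x).

Fact quat_scaleA c d x : quat_scale c (quat_scale d x) = quat_scale (c * d) x.
Proof. by rewrite /quat_scale /= !mulrA. Qed.

Fact quat_scale1 : left_id 1 quat_scale.
Proof. by case=> ? ? ? ?; rewrite /quat_scale /= !mul1r. Qed.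

Fact quat_scaleDr : right_distributive quat_scale +%R.
Proof. by move=> c x y; congr Quat; rewrite /= mulrDr. Qed.

Fact quat_scaleDl x : {morph quat_scale^~ x : c d / c + d}.
Proof. by move=> c d; congr Quat; rewrite /= mulrDl. Qed.

HB.instance Definition _ := GRing.Zmodule_isLmodule.Build F B
  quat_scaleA quat_scale1 quat_scaleDr quat_scaleDl.

Fact quat_scaleAl (c : F) x y : c *: (x * y) = (c *: x) * y.
Proof. by case: x y => ? ? ? ? [? ? ? ?]; congr Quat => /=; ring. Qed.

HB.instance Definition _ := GRing.Lmodule_isLalgebra.Build F B quat_scaleAl.

Fact quat_scaleAr (c : F) x y : c *: (x * y) = x * (c *: y).
Proof. by case: x y => ? ? ? ? [? ? ? ?]; congr Quat => /=; ring. Qed.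

HB.instance Definition _ := GRing.Lalgebra_isAlgebra.Build F B quat_scaleAr.

End Quat.

Definition division_ring (A : nzRingType) : Prop :=
  forall x : A, x != 0 -> exists y : A, x * y = 1 /\ y * x = 1.

(* Below, a and b stand for the algebra (a, b / Q). *)

Definition ramified_at_prime (a b : rat) (p : nat) : Prop :=
  exists p_pr : prime p,
    division_ring (quat (ratr a : padic p_pr) (ratr b : padic p_pr)).

Definition definite (R : realType) (a b : rat) : Prop :=
  division_ring (quat (ratr a : R) (ratr b : R)).

Definition has_discriminant (a b : rat) (D : nat) : Prop :=
  exists s : seq nat,
    [/\ uniq s, forall p, p \in s <-> ramified_at_prime a b p
      & D = (\prod_(p <- s) p)%N].

Section Orders.
Variable B : algType rat.
Implicit Types O M : set B.

(* A Z-order of B: a subring, finitely generated as a Z-module, that spans B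
   over Q. *)
Definition is_order O : Prop :=
  [/\ GRing.subring_closed [in O],
      exists n (e : 'I_n -> B),
        O = [set x | exists c : 'I_n -> int, x = \sum_i e i *~ c i]%classic
    & forall x : B, exists n (e : 'I_n -> B) (c : 'I_n -> rat),
        (forall i, O (e i)) /\ x = \sum_i c i *: e i].

Definition maximal_order O : Prop :=
  is_order O /\ forall M, is_order M -> (O `<=` M)%classic -> M = O.

Definition has_index O M (n : nat) : Prop :=
  exists r : 'I_n -> B,
    (forall i, M (r i)) /\ (forall x, M x -> exists! i, O (x - r i)).

Definition eichler_order O (N : nat) : Prop :=
  exists M1 M2, [/\ maximal_order M1, maximal_order M2,
    O = (M1 `&` M2)%classic, has_index O M1 N & has_index O M2 N].

End Orders.

Definition square_free (n : nat) : Prop :=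
  forall p, prime p -> ~~ (p ^ 2 %| n)%N.

(* Main.v *)
(* The elements omega = (1 + w1)/2 and w2 of an order have 2 trd(omega w2) = trd(w1 w2)
   even, say 2u, and generate a suborder of reduced discriminant Delta = 3m - u^2, which is
   positive since B' is definite. Each prime dividing D'N' divides Delta: at p | D' the algebra
   would split if p did not divide Delta or if p = 1 mod 3, because then -Delta is a norm from
   Q_p(sqrt -3); at q | N' the quotient of a maximal order by O' has q-torsion, whereas it is
   killed by Delta. So m | u^2, hence m | u, and m u'^2 < 3 for u' = u/m, which leaves u = 0
   (where D'N' | 3m) or m = D'N' = 2. For u = 0 and q | m inert in Q(sqrt -3) the suborder is
   maximal at q, which excludes q | N'.

   Conversely, write m = D'N' or D'N'/3 for the choice prime to 3 and take (-3, -m) with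
   i^2 = -3, j^2 = -m. For suitable integers t, e, K the lattice
   M(t, e) = Z + Z omega + Z j + Z (omega - t)(j + e)/K is a maximal order, where t is a root
   of t^2 - t + 1 modulo K, and O' is the intersection of M(t, e) and M(1 - t, e) or
   M(1 - t, -e). Multiplying j by i exchanges the two possible values of m. *)

Require Import Defs.
From HB Require Import structures.
From mathcomp Require Import all_boot all_order all_algebra.
From mathcomp Require Import fingroup perm pgroup finfield.
From mathcomp Require Import boolp classical_sets reals.
From mathcomp Require Import ring lra zify.

Set Implicit Arguments.
Unset Strict Implicit.
Unset Printing Implicit Defensive.

Import Order.TTheory GRing.Theory Num.Theory.
Local Open Scope ring_scope.

(** * The norm form of Q(sqrt -3) modulo primes *)

Lemma intr_eq0_dvdz (A : nzRingType) (d : nat) (z : int) :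
  (forall n : nat, (n%:R == 0 :> A) = (d %| n)%N) ->
  (z%:~R == 0 :> A) = (d %| z)%Z.
Proof.
move=> nat_eq0; case: z => n; first by rewrite -pmulrn nat_eq0.
by rewrite NegzE mulrNz oppr_eq0 -pmulrn nat_eq0.
Qed.

Lemma Fp_int_eq0 (p : nat) (z : int) :
  prime p -> (z%:~R == 0 :> 'F_p) = (p %| z)%Z.
Proof. by move=> p_pr; rewrite (dvdz_pcharf (pchar_Fp p_pr)). Qed.

Lemma Zp_int_eq0 (n : nat) (z : int) :
  (1 < n)%N -> (z%:~R == 0 :> 'Z_n) = (n %| z)%Z.
Proof.
move=> n_gt1; apply: intr_eq0_dvdz => k.
by rewrite -(inj_eq val_inj) /= val_Zp_nat.
Qed.

Lemma prime_dvdz_mul (p : nat) (a b : int) :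
  prime p -> (p %| a * b)%Z = (p %| a)%Z || (p %| b)%Z.
Proof. by move=> p_pr; rewrite -!(Fp_int_eq0 _ p_pr) rmorphM mulf_eq0. Qed.

Section NormForm.
Variables (p : nat) (p_pr : prime p).

(** A root satisfies [x ^+ 3 = 1], so Fermat's [x ^+ p = x] reads [x ^+ 2 = x]. Then [x = 1], and 3
    would vanish in ['F_p]. *)
Lemma cube_root1_mod3 (x : 'F_p) : (p %% 3 = 2)%N -> x ^+ 2 + x + 1 != 0.
Proof.
move=> p2; apply/eqP => x_root.
have x3 : x ^+ 3 = 1 by transitivity ((x - 1) * (x ^+ 2 + x + 1) + 1);
  [ring | rewrite x_root mulr0 add0r].
have x0 : x != 0 by apply: contra_eq_neq x3 => ->; rewrite expr0n eq_sym oner_eq0.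
have xx : x ^+ 2 = x.
  have exp_mod3 n : (n %% 3 = 2)%N -> x ^+ n = x ^+ 2.
    by move=> n2; rewrite (divn_eq n 3) n2 mulnC exprD exprM x3 expr1n mul1r.
  by rewrite -(exp_mod3 p p2) -[RHS]expf_card card_Fp.
have x1 : x = 1 by apply: (mulfI x0); rewrite mulr1 -expr2.
move/eqP: x_root; rewrite x1 (_ : _ + _ = 3%:R); last by ring.
rewrite -(dvdn_pcharf (pchar_Fp p_pr)) dvdn_prime2 // => /eqP p3.
by rewrite p3 in p2.
Qed.

(** Such a [p] is inert in Q(sqrt -3): if [b] were nonzero modulo [p], then [a / b] would be a root
    of X^2 + X + 1. *)
Lemma inert_norm_dvd (a b : int) : (p %% 3 = 2)%N ->
  (p %| a ^+ 2 + a * b + b ^+ 2)%Z -> (p %| a)%Z /\ (p %| b)%Z.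
Proof.
move=> p2; rewrite -!(Fp_int_eq0 _ p_pr) !rmorphD /= !rmorphXn rmorphM /=.
move: (a%:~R) (b%:~R) => x y /eqP xy0.
have [y0|y0] := eqVneq y 0.
  by move: xy0; rewrite y0 mulr0 expr0n /= !addr0 => /eqP; rewrite expf_eq0.
have /eqP[] := cube_root1_mod3 (x / y) p2.
have -> : (x / y) ^+ 2 + x / y + 1 = (x ^+ 2 + x * y + y ^+ 2) / y ^+ 2 by field.
by rewrite xy0 mul0r.
Qed.

(** Modulo [p] only the first binary form survives, so [p] divides [a] and [b] and that form is
    divisible by p^2. As [m] has a single factor [p], the second form is divisible by [p] as
    well. *)
Lemma quaternary_inert_dvd (m a b c d : int) : (p %% 3 = 2)%N ->
  (p %| m)%Z -> ~~ (p%:Z ^+ 2 %| m)%Z ->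
  (p%:Z ^+ 2 %| (a ^+ 2 + a * b + b ^+ 2) + m * (c ^+ 2 + c * d + d ^+ 2))%Z ->
  [/\ (p %| a)%Z, (p %| b)%Z, (p %| c)%Z & (p %| d)%Z].
Proof.
move=> p2 /dvdzP[m' ->] mp pQ; have p0 : (p%:Z != 0) by rewrite -lt0n prime_gt0.
have [pa pb] : (p %| a)%Z /\ (p %| b)%Z.
  apply: (inert_norm_dvd p2); have := dvdz_trans (dvdz_exp2l p%:Z (isT : 1 <= 2)%N) pQ.
  by rewrite expr1 rpredDr // dvdz_mulr // dvdz_mull.
suff [pc pd] : (p %| c)%Z /\ (p %| d)%Z by [].
apply: (inert_norm_dvd p2); case/dvdzP: pa pQ => a' ->; case/dvdzP: pb => b' ->.
rewrite (_ : _ + _ = p%:Z ^+ 2 * (a' ^+ 2 + a' * b' + b' ^+ 2) +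
  (m' * (c ^+ 2 + c * d + d ^+ 2)) * p%:Z); last by ring.
rewrite rpredDl; last by rewrite dvdz_mulr.
rewrite expr2 dvdz_mul2r // prime_dvdz_mul // => /orP[|//].
by move/dvdzP => [m'' m'E]; case/negP: mp; rewrite m'E -mulrA -expr2 dvdz_mull.
Qed.

End NormForm.

(** Modulo 3 the form is (a - b)^2 + (c - d)^2, and -1 is not a square. Putting a = b + 3k, c = d +
    3l and dividing by 3 leaves b^2 + d^2 modulo 3, to which the same argument applies. *)
Lemma quaternary_3_dvd (m a b c d : int) : (3 %| m - 1)%Z ->
  (9 %| (a ^+ 2 + a * b + b ^+ 2) + m * (c ^+ 2 + c * d + d ^+ 2))%Z ->
  [/\ (3 %| a)%Z, (3 %| b)%Z, (3 %| c)%Z & (3 %| d)%Z].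
Proof.
have sq3 (x y : int) : (3 %| x ^+ 2 + y ^+ 2)%Z -> (3 %| x)%Z /\ (3 %| y)%Z.
  move=> h; have [x' [r [xE hr]]] : exists x' r : int, x = x' * 3 + r /\ (r = 0 \/ r = 1 \/ r = -1).
    exists ((x + 1) %/ 3)%Z, (x - ((x + 1) %/ 3)%Z * 3); lia.
  have [y' [s [yE hs]]] : exists y' s : int, y = y' * 3 + s /\ (s = 0 \/ s = 1 \/ s = -1).
    exists ((y + 1) %/ 3)%Z, (y - ((y + 1) %/ 3)%Z * 3); lia.
  move: h; rewrite xE yE.
  rewrite (_ : _ + _ = (3 * x' ^+ 2 + 2 * x' * r + 3 * y' ^+ 2 + 2 * y' * s) * 3
    + (r ^+ 2 + s ^+ 2)); last by ring.
  rewrite rpredDl ?dvdz_mull //.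
  by move: hr hs => [->|[->|->]] [->|[->|->]] // _; rewrite !addr0 !dvdz_mull.
move=> /dvdzP[m' m'E] /dvdzP[q qE].
have mE : m = m' * 3 + 1 by lia.
have [ab cd] : (3 %| a - b)%Z /\ (3 %| c - d)%Z.
  apply: sq3; apply/dvdzP.
  exists (3 * q - a * b - c * d - m' * (c ^+ 2 + c * d + d ^+ 2)).
  have -> : (a - b) ^+ 2 + (c - d) ^+ 2 =
    (a ^+ 2 + a * b + b ^+ 2 + m * (c ^+ 2 + c * d + d ^+ 2)) - 3 * a * b - 3 * c * d
      - m' * 3 * (c ^+ 2 + c * d + d ^+ 2).
    by rewrite mE; ring.
  by rewrite qE; ring.
case/dvdzP: ab => k kE; case/dvdzP: cd => l lE.
have aE : a = b + k * 3 by lia.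
have cE : c = d + l * 3 by lia.
have [b3 d3] : (3 %| b)%Z /\ (3 %| d)%Z.
  apply: sq3; apply/dvdzP.
  exists (q - b * k - k ^+ 2 - m' * d ^+ 2 - m * d * l - m * l ^+ 2).
  apply: (mulfI (isT : 3 != 0 :> int)).
  transitivity (q * 9 - 9 * b * k - 9 * k ^+ 2 - 9 * m' * d ^+ 2
    - 9 * m * d * l - 9 * m * l ^+ 2); last by ring.
  rewrite -qE aE cE {}mE; ring.
by split=> //; rewrite ?aE ?cE rpredDl ?dvdz_mull.
Qed.

(** * Norms, zero divisors and scalar extension of quaternion algebras *)

Section QuatNorm.
Variables (F : fieldType) (a b : F).
Implicit Types x y : quat a b.

Definition nrd x : F :=
  q_1 x ^+ 2 - a * q_i x ^+ 2 - b * q_j x ^+ 2 + a * b * q_k x ^+ 2.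

Definition quat_conj x := Quat a b (q_1 x) (- q_i x) (- q_j x) (- q_k x).

Lemma quatP x y :
  q_1 x = q_1 y -> q_i x = q_i y -> q_j x = q_j y -> q_k x = q_k y -> x = y.
Proof. by case: x y => ? ? ? ? [? ? ? ?] /= -> -> -> ->. Qed.

Lemma nrdM x y : nrd (x * y) = nrd x * nrd y.
Proof. by rewrite /nrd /=; ring. Qed.

Lemma nrdX x n : nrd (x ^+ n) = nrd x ^+ n.
Proof.
elim: n => [|n IHn]; first by rewrite !expr0 /nrd /=; ring.
by rewrite !exprS nrdM IHn.
Qed.

Lemma nrd1D x : nrd (1 + x) = 1 + 2 * q_1 x + nrd x.
Proof. by rewrite /nrd /=; ring. Qed.

Lemma quat_conjK x : x * quat_conj x = (nrd x)%:A /\ quat_conj x * x = (nrd x)%:A.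
Proof. by split; apply: quatP => /=; rewrite /nrd; ring. Qed.

Lemma anisotropic_division :
  (forall x, nrd x = 0 -> x = 0) -> division_ring (quat a b).
Proof.
move=> aniso x x0; have n0 : nrd x != 0 by apply: contraNneq x0 => /aniso ->.
exists ((nrd x)^-1 *: quat_conj x); rewrite -scalerAr -scalerAl.
by case: (quat_conjK x) => -> ->; rewrite scalerA mulVf // scale1r.
Qed.

Lemma quat_natE n : n%:R = Quat a b n%:R 0 0 0.
Proof.
elim: n => [|n IHn]; first by [].
by rewrite !mulrS IHn; apply: quatP => /=; rewrite ?addr0.
Qed.

End QuatNorm.

Lemma division_ring_integral (A : nzRingType) (x y : A) :
  division_ring A -> x * y = 0 -> x != 0 -> y = 0.
Proof.
move=> divA xy0 /divA[z [_ zx]].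
by rewrite -[y]mul1r -zx -mulrA xy0 mulr0.
Qed.

(* If P = alpha + beta w1 has norm -c, then P + j is a zero divisor, because
   (P + j)(conj P - j) = N(P) - j^2 = 0. *)
Lemma split_not_division (F : fieldType) (A : algType F) (w j : A)
    (alpha beta c : F) :
  2%:R * (3%:R * c) != 0 :> F -> w ^+ 2 = - 3%:R -> j ^+ 2 = - c%:A ->
  w * j = - (j * w) -> alpha ^+ 2 + 3%:R * beta ^+ 2 + c = 0 ->
  ~ division_ring A.
Proof.
move=> c0 ww jj wj abc divA.
(* Neither factor of the zero divisor vanishes: elements of F + F w commute with [w], while [j]
   anticommutes, so equality would give 2 w j = 0, and w (w j) j = 3c turns this into 6c = 0. *)
have j_notin x y : j != x%:A + y *: w.
  apply/eqP => jE; have jw : j * w = w * j.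
    by rewrite jE mulrDr mulrDl -!scalerAr -!scalerAl mulr1 mul1r.
  have wj2 : 2%:R *: (w * j) = 0 :> A.
    by rewrite scaler_nat mulr2n {1}wj jw addNr.
  have /eqP : 2%:R *: (w * (w * j) * j) = 0 :> A.
    by rewrite scalerAl scalerAr wj2 mulr0 mul0r.
  rewrite mulrA -mulrA -!expr2 ww jj mulrNN mulr_algr -scaler_nat !scalerA.
  by rewrite scaler_eq0 oner_eq0 orbF mulrAC -mulrA (negPf c0).
pose P s := alpha%:A + s *: w.
have PP : P beta * P (- beta) = (alpha ^+ 2 + 3%:R * beta ^+ 2)%:A.
  rewrite /P mulrDl !mulrDr -!scalerAr -!scalerAl !mulr1 mul1r -expr2 ww !scalerA.
  rewrite -addrA (addrA (_ *: w)) -scalerDl (mulrC alpha beta) mulNr addNr scale0r add0r.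
  by rewrite scalerN -scaler_nat scalerA -scaleNr -scalerDl; congr (_ *: _); ring.
have Pj : P beta * j = j * P (- beta).
  rewrite /P mulrDl mulrDr -!scalerAr -!scalerAl mulr1 mul1r wj.
  by rewrite scalerN scaleNr.
have z0 : (P beta + j) * (P (- beta) - j) = 0.
  by rewrite mulrDl !mulrBr Pj PP -!expr2 jj opprK addrA subrK -scalerDl abc scale0r.
have nz : P beta + j != 0.
  apply: contraNneq (j_notin (- alpha) (- beta)) => /eqP.
  by rewrite addrC addr_eq0 /P opprD !scaleNr.
have /eqP := division_ring_integral divA z0 nz.
by rewrite subr_eq0 eq_sym; apply/negP/j_notin.
Qed.

(** * Scalar extension from Q to a field of characteristic zero *)

Section RatrChar0.
Variables (F : fieldType) (F0 : [pchar F] =i pred0).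

Lemma intr_eq0_char0 (z : int) : (z%:~R == 0 :> F) = (z == 0).
Proof.
case: z => n; first by rewrite -pmulrn ((pcharf0P F).1 F0).
by rewrite NegzE mulrNz !oppr_eq0 -pmulrn ((pcharf0P F).1 F0).
Qed.

Lemma ratr_div (n d : int) : d != 0 -> ratr (n%:~R / d%:~R) = n%:~R / d%:~R :> F.
Proof.
move=> d0; have dF : d%:~R != 0 :> F by rewrite intr_eq0_char0.
have dQ : d%:~R != 0 :> rat by rewrite intr_eq0.
set x := n%:~R / _; have xF : (denq x)%:~R != 0 :> F by rewrite intr_eq0_char0 denq_neq0.
apply/eqP; rewrite eqr_div // -!rmorphM -subr_eq0 -rmorphB intr_eq0_char0 subr_eq0.
rewrite -(eqr_int rat) !rmorphM /= -eqr_div ?intr_eq0 ?denq_neq0 //.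
by rewrite divq_num_den.
Qed.

(** [ratr] under its own name, to carry ring morphism instances over any field of characteristic
    zero. *)
Definition rat_embed (x : rat) : F := ratr x.

Fact rat_embed_is_zmod_morphism : zmod_morphism rat_embed.
Proof.
move=> x y; rewrite /rat_embed -[in LHS](divq_num_den x) -[in LHS](divq_num_den y).
have dx := denq_neq0 x; have dy := denq_neq0 y.
rewrite -mulNr -rmorphN addf_div ?intr_eq0 //= -!rmorphM -rmorphD /= ratr_div ?mulf_neq0 //.
by rewrite /ratr -mulNr addf_div ?intr_eq0_char0 // rmorphD !rmorphM rmorphN.
Qed.

Fact rat_embed_is_monoid_morphism : monoid_morphism rat_embed.
Proof.
split=> [|x y]; first by rewrite /rat_embed /ratr divr1.
rewrite /rat_embed -[in LHS](divq_num_den x) -[in LHS](divq_num_den y).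
have dx := denq_neq0 x; have dy := denq_neq0 y.
rewrite mulf_div -!rmorphM /= ratr_div ?mulf_neq0 //.
by rewrite /ratr mulf_div -!rmorphM.
Qed.

HB.instance Definition _ :=
  GRing.isZmodMorphism.Build rat F rat_embed rat_embed_is_zmod_morphism.
HB.instance Definition _ :=
  GRing.isMonoidMorphism.Build rat F rat_embed rat_embed_is_monoid_morphism.

Variables a b : rat.

Definition quat_ext (x : quat a b) : quat (ratr a : F) (ratr b) :=
  Quat _ _ (rat_embed (q_1 x)) (rat_embed (q_i x)) (rat_embed (q_j x))
    (rat_embed (q_k x)).

Lemma quat_extN x : quat_ext (- x) = - quat_ext x.
Proof. by apply: quatP => /=; rewrite rmorphN. Qed.

Lemma quat_extM x y : quat_ext (x * y) = quat_ext x * quat_ext y.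
Proof.
by apply: quatP => /=; rewrite ?(rmorphD, rmorphN, rmorphM).
Qed.

Lemma quat_extZ c x : quat_ext (c *: x) = rat_embed c *: quat_ext x.
Proof. by apply: quatP => /=; rewrite rmorphM. Qed.

Lemma quat_ext1 : quat_ext 1 = 1.
Proof. by apply: quatP => /=; rewrite ?rmorph0 ?rmorph1. Qed.

(** The relations of [w] and [j] hold over Q and pass to the scalar extension, so only the
    representation of [- c] has to be found in [F]. *)
Lemma quat_ext_split (w j : quat a b) (c : rat) (alpha beta : F) :
  w ^+ 2 = - 3%:R -> j ^+ 2 = - c%:A -> w * j = - (j * w) -> c != 0 ->
  alpha ^+ 2 + 3%:R * beta ^+ 2 + rat_embed c = 0 ->
  ~ division_ring (quat (ratr a : F) (ratr b)).
Proof.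
move=> ww jj wj c0 abc.
apply: (@split_not_division F _ (quat_ext w) (quat_ext j) alpha beta _ _ _ _ _ abc).
- apply: mulf_neq0; last apply: mulf_neq0; rewrite ?((pcharf0P F).1 F0) //.
  by rewrite fmorph_eq0.
- by rewrite expr2 -quat_extM -expr2 ww -scaler_nat quat_extN quat_extZ quat_ext1
    rmorph_nat scaler_nat.
- by rewrite expr2 -quat_extM -expr2 jj quat_extN quat_extZ quat_ext1.
- by rewrite -!quat_extM wj quat_extN.
Qed.

End RatrChar0.

(** Each power of the denominator of [r] is coprime to the same power of the numerator and hence
    divides [d]. A denominator above 1 would outgrow [d] at the exponent [|d|]. *)
Lemma denominators_bounded_int (r : rat) (d : int) :
  d != 0 -> (forall n, d%:~R * r ^+ n \is a Num.int) -> r \is a Num.int.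
Proof.
move=> d0 bnd; suff : denq r == 1 by rewrite Qint_def.
have dvd_d n : (denq r ^+ n %| d)%Z.
  have /intrP[z] := bnd n; rewrite -{1}(divq_num_den r) expr_div_n => zE.
  have : d * numq r ^+ n = z * denq r ^+ n.
    apply/eqP; rewrite -(eqr_int rat) !rmorphM !rmorphXn /= -zE mulrA divfK //.
    by rewrite expf_neq0 // intr_eq0 denq_neq0.
  move=> dz; have : (denq r ^+ n %| d * numq r ^+ n)%Z by rewrite dz dvdz_mull.
  rewrite Gauss_dvdzl //; apply/coprimezXl/coprimezXr.
  by rewrite coprimezE coprime_sym coprime_num_den.
have [den1|] := leqP `|denq r| 1; first by have := denq_gt0 r; lia.
move=> den_gt1; have := dvd_d `|d|%N.
rewrite dvdzE abszX => /dvdn_leq; rewrite lt0n absz_eq0 d0 => /(_ isT).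
by rewrite leqNgt (ltn_expl _ den_gt1).
Qed.

(** * Reduction and Hensel lifting for p-adic integers *)

Section PadicReduction.
Variables (p : nat) (p_pr : prime p).
Implicit Types x y : padic_int p_pr.

Lemma padic_modulus_gt1 k : (1 < p ^ k.+1)%N.
Proof. by rewrite -(exp1n k.+1) ltn_exp2r // prime_gt1. Qed.

(** The exponent [k.+1] keeps the modulus above 1, where ['Z_n] really is Z/n. *)
Definition padic_red k x : 'Z_(p ^ k.+1) := (x k.+1)%:R.

Fact padic_red_is_zmod_morphism k : zmod_morphism (padic_red k).
Proof.
move=> x y; have redD u v : padic_red k (u + v) = padic_red k u + padic_red k v.
  by rewrite /padic_red /= Zp_nat_mod ?padic_modulus_gt1 // natrD.
by rewrite -[x in RHS](subrK y) [in RHS]redD addrK.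
Qed.

Fact padic_red_is_monoid_morphism k : monoid_morphism (padic_red k).
Proof.
split=> [|x y]; rewrite /padic_red /= Zp_nat_mod ?padic_modulus_gt1 //.
by rewrite natrM.
Qed.

HB.instance Definition _ k := GRing.isZmodMorphism.Build
  (padic_int p_pr) 'Z_(p ^ k.+1) (padic_red k) (padic_red_is_zmod_morphism k).
HB.instance Definition _ k := GRing.isMonoidMorphism.Build
  (padic_int p_pr) 'Z_(p ^ k.+1) (padic_red k) (padic_red_is_monoid_morphism k).

Lemma padic_red_intE k x : padic_red k x = ((x k.+1)%:Z)%:~R.
Proof. by []. Qed.

Lemma padic_red_eq0 x : (forall k, padic_red k x = 0) -> x = 0.
Proof.
move=> x0; apply: padic_ext => -[|k] /=.
  by have := padic_res_lt x 0; rewrite expn0 ltnS leqn0 mod0n => /eqP.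
have /eqP := x0 k; rewrite padic_red_intE Zp_int_eq0 ?padic_modulus_gt1 // => dvd_x.
by have : (p ^ k.+1 %| x k.+1)%N by []; rewrite /dvdn padic_mod mod0n => /eqP.
Qed.

Lemma padic_pchar : [pchar (padic p_pr)] =i pred0.
Proof.
have nat0 n : (n%:R == 0 :> padic_int p_pr) = (n == 0)%N.
  apply/idP/idP => [/eqP n0|/eqP-> //].
  have := congr1 (padic_red n) n0; rewrite rmorph0 rmorph_nat => /eqP.
  rewrite pmulrn Zp_int_eq0 ?padic_modulus_gt1 // => dvd_n.
  have {dvd_n} : (p ^ n.+1 %| n)%N by []; move=> /dvdn_leq; case: (n) => // m /(_ isT).
  by rewrite leqNgt (ltn_trans (ltnSn _)) // ltn_expl // prime_gt1.
by apply/pcharf0P => n; rewrite -(rmorph_nat (@FracField.tofrac _)) tofrac_eq0.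
Qed.

Lemma padic_frac (x : padic p_pr) :
  exists n d : padic_int p_pr, d != 0 /\ x * FracField.tofrac d = FracField.tofrac n.
Proof.
elim/quotW: x => r; exists (frac r).1, (frac r).2.
split; first exact: denom_ratioP.
unlock FracField.tofrac; rewrite -[LHS]FracField.pi_mul.
apply/eqmodP; rewrite /= FracField.equivfE /FracField.mulf.
by rewrite !numden_Ratio ?mulf_neq0 ?oner_eq0 ?denom_ratioP // !mulr1 mulrC.
Qed.

(* Newton iteration with the constant slope r + 2 z_0, whose inverse mod p is v. *)
Lemma hensel_quadratic (r s z0 : int) :
  (p %| z0 ^+ 2 + r * z0 + s)%Z -> ~~ (p %| 2 * z0 + r)%Z ->
  exists x : padic_int p_pr, x ^+ 2 + r%:~R * x + s%:~R = 0.
Proof.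
pose f (t : int) : int := t ^+ 2 + r * t + s; move=> pf0 pf'.
have [[u v] /= uv] : exists uv : int * int, uv.1 * p + uv.2 * (2 * z0 + r) = 1.
  have : coprimez p (2 * z0 + r) by rewrite coprimezE prime_coprime.
  by case/coprimezP=> -[u v] /= uv; exists (u, v).
pose z n := iter n (fun t : int => t - v * f t) z0.
have z_mod n : (p %| z n - z0)%Z /\ (p%:Z ^+ n.+1 %| f (z n))%Z.
  elim: n => [|n [IH1 IH2]]; first by rewrite subrr dvdz0 expr1.
  have pfz : (p %| f (z n))%Z by apply: dvdz_trans IH2; rewrite exprS dvdz_mulr.
  split; first by rewrite /= addrAC rpredB // dvdz_mull.
  case/dvdzP: IH2 => q qE; case/dvdzP: IH1 => l lE; case/dvdzP: pfz => q' q'E.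
  rewrite /= -/(z n); set y := z n in qE lE q'E *.
  have -> : f (y - v * f y) = f y * (1 - v * (2 * z0 + r) - v * 2 * (y - z0) + v ^+ 2 * f y).
    by rewrite /f; ring.
  have vE : v * (2 * z0 + r) = 1 - u * p by apply/eqP; rewrite eq_sym subr_eq addrC uv.
  rewrite {1}qE lE q'E vE.
  by apply/dvdzP; exists (q * (u - v * 2 * l + v ^+ 2 * q')); rewrite !exprS; ring.
have p0 k : (p%:Z ^+ k != 0) by rewrite expf_neq0 // -lt0n prime_gt0.
have PX k : (p ^ k)%N%:Z = p%:Z ^+ k by rewrite -!natz natrX.
pose res n := `|(z n %% p%:Z ^+ n)%Z|%N.
have resE n : (res n)%:Z = (z n %% p%:Z ^+ n)%Z by rewrite /res gez0_abs // modz_ge0.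
have compat n : (res n.+1 %% p ^ n)%N = res n.
  apply/eqP; rewrite -eqz_nat -modz_nat !resE PX eqz_mod_dvd.
  rewrite /modz addrAC -mulNr.
  rewrite rpredD ?dvdz_mull ?dvdz_exp2l //.
  rewrite [z n.+1]/= -/(z n) addrC addKr rpredN dvdz_mull //.
  by apply: dvdz_trans (z_mod n).2; exact: dvdz_exp2l.
exists (PadicInt p_pr compat); apply: padic_red_eq0 => k.
have xE : padic_red k (PadicInt p_pr compat) = (z k.+1)%:~R.
  rewrite padic_red_intE resE; apply/eqP; rewrite -subr_eq0 -rmorphB /=.
  rewrite Zp_int_eq0 ?padic_modulus_gt1 // PX -eqz_mod_dvd modz_mod //.
rewrite !(rmorphD, rmorphM, rmorphXn) /= xE !rmorph_int -rmorphXn -!rmorphM -!rmorphD.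
apply/eqP; rewrite Zp_int_eq0 ?padic_modulus_gt1 //.
apply: dvdz_trans (z_mod k.+1).2; rewrite PX; exact: dvdz_exp2l.
Qed.

End PadicReduction.

(** * Local splitting and ramification of (-3, -m) *)

(** As 3 divides the order [p - 1] of the unit group, Cauchy's theorem gives an element of order 3;
    its negative, a primitive sixth root of unity, is the root. *)
Lemma mod3_1_root (p : nat) : prime p -> (p %% 3 = 1)%N ->
  exists t : int, (p %| t ^+ 2 - t + 1)%Z.
Proof.
move=> p_pr p1; have [//||u _ u3] := @Cauchy _ 3 [set: {unit 'F_p}]%G.
  by rewrite card_finField_unit card_Fp //; lia.
pose x : 'F_p := val u; have x3 : x ^+ 3 = 1.
  by rewrite /x -FinRing.val_unitX -u3 expg_order.
have x1 : x - 1 != 0.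
  rewrite subr_eq0; apply/eqP => x1; have u1 : u = 1%g by apply: val_inj.
  by move: u3; rewrite u1 order1.
have xr : x ^+ 2 + x + 1 = 0.
  apply: (mulfI x1); rewrite mulr0 (_ : _ * _ = x ^+ 3 - 1); last by ring.
  by rewrite x3 subrr.
exists (- (x : nat)%:Z); rewrite -(Fp_int_eq0 _ p_pr).
have xE : ((x : nat)%:Z)%:~R = x by rewrite -pmulrn natr_Zp.
by rewrite rmorphD rmorphB rmorphXn rmorphN /= xE sqrrN opprK xr.
Qed.

(** Pigeonhole for odd [p]: the values i^2 and the values -c - 3 j^2, for i, j up to (p - 1)/2,
    number (p + 1)/2 each and must meet in ['F_p]. The choice a = i - j, b = 2j turns i^2 + 3 j^2
    into a^2 + ab + b^2. *)
Lemma norm_form_mod (p : nat) (c : int) : prime p -> p != 3%N ->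
  exists a b : int, (p %| a ^+ 2 + a * b + b ^+ 2 + c)%Z.
Proof.
move=> p_pr p3; have [p2|p_odd] := even_prime p_pr.
  case: (boolP (2 %| c)%Z) => c2; first by exists 0, 0; rewrite p2 !mul0r !add0r.
  by exists 1, 0; rewrite p2; lia.
pose h := p./2; have pE : p = h.*2.+1 by rewrite -[LHS]odd_double_half p_odd.
have sq_inj (i j : 'I_h.+1) : (i%:R ^+ 2 : 'F_p) = j%:R ^+ 2 -> i = j.
  move/eqP; rewrite -subr_eq0 subr_sqr.
  wlog le_ij : i j / (j <= i)%N.
    move=> W; case: (leqP j i) => [/W//|/ltnW le_ij].
    rewrite (_ : _ * _ = - ((j%:R - i%:R) * (j%:R + i%:R))); last by ring.
    by rewrite oppr_eq0 => /(W _ _ le_ij).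
  rewrite -natrB // -natrD mulf_eq0 -!(dvdn_pcharf (pchar_Fp p_pr)).
  have := ltn_ord i; have := ltn_ord j => hj hi /orP[] /dvdnP[[|k] kE]; apply: val_inj => /=; nia.
pose A := [set (i%:R ^+ 2 : 'F_p) | i : 'I_h.+1].
pose B := [set - c%:~R - 3%:R * (i%:R ^+ 2 : 'F_p) | i : 'I_h.+1].
have cardA : #|A| = h.+1 by rewrite card_imset ?card_ord.
have cardB : #|B| = h.+1.
  rewrite card_imset ?card_ord // => i j /addrI /oppr_inj /mulfI eq3.
  apply/sq_inj/eq3; rewrite -(dvdn_pcharf (pchar_Fp p_pr)).
  by apply: contra p3; rewrite dvdn_prime2.
have : A :&: B != finset.set0.
  apply: contraTneq (max_card (A :|: B)) => AB0.
  by rewrite cardsU AB0 cards0 subn0 cardA cardB card_Fp // -ltnNge; lia.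
case/finset.set0Pn => z; rewrite finset.inE => /andP[/imsetP[i _ ->] /imsetP[j _ /eqP ij]].
exists ((i : nat)%:Z - (j : nat)%:Z), (2 * (j : nat)%:Z).
rewrite (_ : _ + c = (i : nat)%:Z ^+ 2 + 3 * (j : nat)%:Z ^+ 2 + c); last by ring.
rewrite -(Fp_int_eq0 _ p_pr) !rmorphD rmorphM !rmorphXn /= -!pmulrn.
by move: ij; rewrite -subr_eq0; congr (_ == _); ring.
Qed.

(** With a square root [s] of -3 the form factors as (alpha + s beta)(alpha - s beta); here the
    factors are [- c] and 1. *)
Lemma norm_rep_sqrt (F : fieldType) (s c : F) :
  2%:R != 0 :> F -> s != 0 -> s ^+ 2 = - 3%:R ->
  ((1 - c) / 2%:R) ^+ 2 + 3%:R * ((- c - 1) / (2%:R * s)) ^+ 2 + c = 0.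
Proof.
move=> two s0 ss; have -> : 3%:R = - s ^+ 2 by rewrite ss opprK.
by field; rewrite s0 two.
Qed.

(** In the first case a solution modulo [p] lifts by Hensel's lemma, in the second Q_p contains sqrt
    -3, and in the third [- c] is 1 modulo 3 and hence a square. *)
Lemma padic_norm_rep (p : nat) (p_pr : prime p) (c : int) :
  [\/ p != 3%N /\ ~~ (p %| c)%Z, (p %% 3 = 1)%N | p = 3%N /\ (3 %| c + 1)%Z] ->
  exists alpha beta : padic p_pr, alpha ^+ 2 + 3%:R * beta ^+ 2 + c%:~R = 0.
Proof.
have F0 := padic_pchar p_pr; have natF n := (pcharf0P (padic p_pr)).1 F0 n.
have two : 2%:R != 0 :> padic p_pr by rewrite natF.
pose iota : {rmorphism padic_int p_pr -> padic p_pr} := @FracField.tofrac (padic_int p_pr).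
case=> [[p3 pc]|p1|[p3 c2]].
(* With alpha = a + x/2 and beta = x/2 the form alpha^2 + 3 beta^2 becomes x^2 + ax + a^2. *)
- suff [x [a xa]] : exists (x : padic_int p_pr) (a : int),
      x ^+ 2 + a%:~R * x + (a ^+ 2 + c)%:~R = 0.
    exists (a%:~R + iota x / 2%:R), (iota x / 2%:R).
    transitivity (iota (x ^+ 2 + a%:~R * x + (a ^+ 2 + c)%:~R)); last by rewrite xa rmorph0.
    rewrite !(rmorphD, rmorphM, rmorphXn) /= !(rmorph_int iota).
    by field.
  have [a [b pab]] := norm_form_mod c p_pr p3.
  (* One coordinate is lifted, along a partial derivative that is nonzero modulo [p]. If both
     vanish, [p] divides [a] and [b], hence [c], against the hypothesis. *)
  case: (boolP (p %| 2 * b + a)%Z) => pba; last first.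
    have [|//|x xE] := @hensel_quadratic _ p_pr a (a ^+ 2 + c) b; last by exists x, a.
    by rewrite (_ : _ + _ = a ^+ 2 + a * b + b ^+ 2 + c) //; ring.
  case: (boolP (p %| 2 * a + b)%Z) => pab'; last first.
    have [|//|x xE] := @hensel_quadratic _ p_pr b (b ^+ 2 + c) a; last by exists x, b.
    by rewrite (_ : _ + _ = a ^+ 2 + a * b + b ^+ 2 + c) //; ring.
  case/negP: pc; have p3' : (p %| 3)%Z = false.
    by apply/negbTE; apply: contra p3; rewrite -(dvdn_prime2 p_pr).
  have pa : (p %| a)%Z.
    have : (p %| 3 * a)%Z; last by rewrite prime_dvdz_mul // p3'.
    rewrite (_ : 3 * a = 2 * (2 * a + b) - (2 * b + a)); last by ring.
    by rewrite rpredB // dvdz_mull.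
  have pb : (p %| b)%Z by rewrite (_ : b = (2 * a + b) - 2 * a) ?rpredB ?dvdz_mull //; ring.
  rewrite (_ : c = (a ^+ 2 + a * b + b ^+ 2 + c) - (a * a + a * b + b * b)); last by ring.
  by rewrite rpredB // !rpredD ?dvdz_mull.
- have [t pt] := mod3_1_root p_pr p1.
  have [x xE] : exists x : padic_int p_pr, x ^+ 2 + (-1)%:~R * x + 1%:~R = 0.
    apply: (@hensel_quadratic _ p_pr (-1) 1 t); first by rewrite mulN1r.
    apply: contra_eqN p1 => pt2; have p3 : (p %| 3)%Z.
      rewrite (_ : 3%:Z = 4 * (t ^+ 2 - t + 1) - (2 * t + -1) * (2 * t - 1)); last by ring.
      by rewrite rpredB ?dvdz_mull ?dvdz_mulr.
    by move: (p3 : (p %| 3)%N); rewrite dvdn_prime2 // => /eqP->.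
  pose s := 2%:R * iota x - 1.
  have ss : s ^+ 2 = - 3%:R.
    transitivity (4%:R * iota (x ^+ 2 + (-1)%:~R * x + 1%:~R) - 3%:R);
      last by rewrite xE rmorph0; ring.
    by rewrite !(rmorphD, rmorphM, rmorphXn) /= !(rmorph_int iota) /s; ring.
  have s0 : s != 0 by apply: contra_eq_neq ss => ->; rewrite expr0n eq_sym oppr_eq0 natF.
  exists ((1 - c%:~R) / 2%:R), ((- c%:~R - 1) / (2%:R * s)).
  exact: norm_rep_sqrt.
- have [||x xE] := @hensel_quadratic _ p_pr 0 c 1.
  + by rewrite p3 mul0r addr0 addrC.
  + by rewrite p3.
  exists (iota x), 0; rewrite expr0n mulr0 addr0 -(rmorph_int iota) -rmorphXn -rmorphD /=.
  by rewrite -[RHS](rmorph0 iota) -xE rmorph0 mul0r addr0.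
Qed.

(** The reduced norm of a + b omega + (c + d omega) j, for omega = (1 + sqrt -3)/2 and j^2 = -m with
    j anticommuting with sqrt -3. *)
Definition qform (A : pzRingType) (m a b c d : A) : A :=
  (a ^+ 2 + a * b + b ^+ 2) + m * (c ^+ 2 + c * d + d ^+ 2).

(** It serves twice: iterated, it gives anisotropy over Q_p; applied to elements of integral norm,
    it cancels factors [p] from coordinates in [lattice_maximal]. *)
Definition strongly_anisotropic (p : nat) (m : int) := forall a b c d : int,
  (p%:Z ^+ 2 %| qform m a b c d)%Z ->
  [/\ (p %| a)%Z, (p %| b)%Z, (p %| c)%Z & (p %| d)%Z].

(** * Ramification at [p] from anisotropy modulo p^2 *)

Section Anisotropic.
Variables (p : nat) (p_pr : prime p) (m : int).
Hypothesis aniso : strongly_anisotropic p m.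

Lemma strongly_anisotropicX n (a b c d : int) :
  (p%:Z ^+ n.*2 %| qform m a b c d)%Z ->
  [/\ (p%:Z ^+ n %| a)%Z, (p%:Z ^+ n %| b)%Z, (p%:Z ^+ n %| c)%Z & (p%:Z ^+ n %| d)%Z].
Proof.
elim: n a b c d => [|n IHn] a b c d; first by rewrite !dvd1z.
rewrite doubleS => pQ; have [] := aniso (dvdz_trans (dvdz_exp2l _ (isT : 2 <= n.*2.+2)%N) pQ).
have p0 : (p%:Z != 0) by rewrite -lt0n prime_gt0.
move=> /dvdzP[a' aE] /dvdzP[b' bE] /dvdzP[c' cE] /dvdzP[d' dE].
move: pQ; rewrite (_ : qform m a b c d = p%:Z ^+ 2 * qform m a' b' c' d'); last first.
  by rewrite /qform aE bE cE dE; ring.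
rewrite -[n.*2.+2]/(2 + n.*2)%N exprD dvdz_mul2l ?expf_neq0 // => /IHn[ha hb hc hd].
by rewrite aE bE cE dE exprSr !dvdz_mul2r.
Qed.

(** Reducing a zero modulo p^(2n+1) gives integers to which [strongly_anisotropicX] applies, so all
    coordinates vanish modulo p^n, for every n. *)
Lemma padic_int_anisotropic (a b c d : padic_int p_pr) :
  qform m%:~R a b c d = 0 -> [/\ a = 0, b = 0, c = 0 & d = 0].
Proof.
move=> Q0; have res0 n : [/\ a n = 0%N, b n = 0%N, c n = 0%N & d n = 0%N].
  have dvd_res (x : padic_int p_pr) k : (n <= k)%N ->
      (p%:Z ^+ n %| (x k)%:Z)%Z -> x n = 0%N.
    move=> le_nk h; have {h} : (p ^ n %| x k)%N by move: h; rewrite /dvdz abszX.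
    by rewrite -(padic_res_le x le_nk) => /eqP.
  have le_n : (n <= n.*2.+1)%N by rewrite -addnn -addnS leq_addr.
  have [] : [/\ (p%:Z ^+ n %| (a n.*2.+1)%:Z)%Z, (p%:Z ^+ n %| (b n.*2.+1)%:Z)%Z,
    (p%:Z ^+ n %| (c n.*2.+1)%:Z)%Z & (p%:Z ^+ n %| (d n.*2.+1)%:Z)%Z].
    apply: strongly_anisotropicX; apply: (@dvdz_trans (p ^ n.*2.+1)%N%:Z).
      by rewrite -!natz natrX natz dvdz_exp2l.
    rewrite -(Zp_int_eq0 _ (padic_modulus_gt1 p_pr n.*2)).
    have /eqP := congr1 (padic_red n.*2) Q0; rewrite rmorph0.
    by rewrite /qform !(rmorphD, rmorphM, rmorphXn) /= rmorph_int !padic_red_intE.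
  by move=> *; split; apply: dvd_res le_n _.
by split; apply: padic_ext => n; have [] := res0 n; rewrite /= mod0n.
Qed.

(** Change of basis from 1, sqrt -3 to 1, omega, using x + y sqrt -3 = (x - y) + 2y omega; the
    factor [d] clears denominators. *)
Lemma norm_form_scale (F : fieldType) (k x y z t d : F) :
  x ^+ 2 + 3%:R * y ^+ 2 + k * z ^+ 2 + 3%:R * k * t ^+ 2 = 0 ->
  qform k (x * d - y * d) (2%:R * (y * d)) (z * d - t * d) (2%:R * (t * d)) = 0.
Proof.
by move=> N0; rewrite -(mulr0 (d ^+ 2)) -N0 /qform; ring.
Qed.

Lemma padic_division :
  division_ring (quat (ratr (- 3%:R) : padic p_pr) (ratr (- m%:~R))).
Proof.
have F0 := padic_pchar p_pr; have natF n := (pcharf0P (padic p_pr)).1 F0 n.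
rewrite -!rmorphN -[- 3%:R]/((- 3)%:~R) !ratr_int.
apply: anisotropic_division => x; rewrite /nrd.
pose iota : {rmorphism padic_int p_pr -> padic p_pr} := @FracField.tofrac (padic_int p_pr).
have [n1 [d1 [d10 x1E]]] := padic_frac (q_1 x).
have [n2 [d2 [d20 x2E]]] := padic_frac (q_i x).
have [n3 [d3 [d30 x3E]]] := padic_frac (q_j x).
have [n4 [d4 [d40 x4E]]] := padic_frac (q_k x).
pose D := d1 * d2 * d3 * d4; have D0 : iota D != 0.
  by rewrite tofrac_eq0 !mulf_neq0.
have [y1 y1E] : exists y, iota y = q_1 x * iota D.
  by exists (n1 * d2 * d3 * d4); rewrite /D !rmorphM /= -x1E; ring.
have [y2 y2E] : exists y, iota y = q_i x * iota D.
  by exists (n2 * d1 * d3 * d4); rewrite /D !rmorphM /= -x2E; ring.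
have [y3 y3E] : exists y, iota y = q_j x * iota D.
  by exists (n3 * d1 * d2 * d4); rewrite /D !rmorphM /= -x3E; ring.
have [y4 y4E] : exists y, iota y = q_k x * iota D.
  by exists (n4 * d1 * d2 * d3); rewrite /D !rmorphM /= -x4E; ring.
clearbody D.
move=> nx0; have [two twoE] : exists two : padic_int p_pr, two = 2%:R by exists 2%:R.
have iota2 : iota two = 2%:R by rewrite twoE rmorph_nat.
have [|/eqP h1 /eqP h2 /eqP h3 /eqP h4] :=
  @padic_int_anisotropic (y1 - y2) (two * y2) (y3 - y4) (two * y4).
  apply/eqP; rewrite -tofrac_eq0; apply/eqP; rewrite -[LHS]/(iota _) /qform.
  rewrite !(rmorphB, rmorphD, rmorphM, rmorphXn) iota2 (rmorph_int iota).
  rewrite !rmorphN y1E y2E y3E y4E; apply: (@norm_form_scale _ m%:~R _ _ _ _ (iota D)).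
  by rewrite -nx0; ring.
have two0 : two != 0 by rewrite -tofrac_eq0 -[FracField.tofrac _]/(iota _) iota2 natF.
move: h2 h4; rewrite !mulf_eq0 (negPf two0) /= => /eqP y20 /eqP y40.
move: h1 h3; rewrite y20 y40 !subr0 => /eqP y10 /eqP y30.
have q0 (q : padic p_pr) y : iota y = q * iota D -> y = 0 -> q = 0.
  by move=> + y0; rewrite y0 rmorph0 => /esym/eqP; rewrite mulf_eq0 (negPf D0) orbF => /eqP.
by apply: quatP; [apply: q0 y1E y10|apply: q0 y2E y20|apply: q0 y3E y30|apply: q0 y4E y40].
Qed.

End Anisotropic.

(** * Integrality in orders and torsion in quotients of orders *)

Lemma fg_denominator (V : zmodType) (g : {additive V -> rat}) n (e : 'I_n -> V) :
  exists2 d : int, d != 0 &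
    forall c : 'I_n -> int, d%:~R * g (\sum_i e i *~ c i) \is a Num.int.
Proof.
exists (\prod_i denq (g (e i))); first by apply/prodf_neq0 => i _; rewrite denq_neq0.
move=> c; rewrite raddf_sum mulr_sumr; apply: rpred_sum => i _.
rewrite raddfMz -[_ *~ c i]mulrzr mulrA rpredM ?rpred_int //.
rewrite (bigD1 i) //= rmorphM /= mulrAC rpredM ?rpred_int //.
by rewrite mulrC -numqE rpred_int.
Qed.

Section QuatAdditive.
Variables (F : fieldType) (a b : F).

Fact q_1_is_zmod_morphism : zmod_morphism (@q_1 F a b). Proof. by []. Qed.
Fact q_i_is_zmod_morphism : zmod_morphism (@q_i F a b). Proof. by []. Qed.
Fact q_j_is_zmod_morphism : zmod_morphism (@q_j F a b). Proof. by []. Qed.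
Fact q_k_is_zmod_morphism : zmod_morphism (@q_k F a b). Proof. by []. Qed.

HB.instance Definition _ := GRing.isZmodMorphism.Build (quat a b) F (@q_1 F a b)
  q_1_is_zmod_morphism.
HB.instance Definition _ := GRing.isZmodMorphism.Build (quat a b) F (@q_i F a b)
  q_i_is_zmod_morphism.
HB.instance Definition _ := GRing.isZmodMorphism.Build (quat a b) F (@q_j F a b)
  q_j_is_zmod_morphism.
HB.instance Definition _ := GRing.isZmodMorphism.Build (quat a b) F (@q_k F a b)
  q_k_is_zmod_morphism.

End QuatAdditive.

Section SubringSet.
Variables (B : nzRingType) (S : set B).
Hypothesis subS : GRing.subring_closed [in S].

Lemma subring_set1 : S 1.
Proof. by case: subS => S1 _ _; apply: set_mem. Qed.

Lemma subring_setB x y : S x -> S y -> S (x - y).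
Proof. by case: subS => _ SB _ /mem_set Sx /mem_set Sy; apply/set_mem/SB. Qed.

Lemma subring_setM x y : S x -> S y -> S (x * y).
Proof. by case: subS => _ _ SM /mem_set Sx /mem_set Sy; apply/set_mem/SM. Qed.

Lemma subring_set0 : S 0.
Proof. by rewrite -(subrr 1); apply: subring_setB subring_set1 subring_set1. Qed.

Lemma subring_setN x : S x -> S (- x).
Proof. by move=> Sx; rewrite -sub0r; apply: subring_setB Sx; exact: subring_set0. Qed.

Lemma subring_setD x y : S x -> S y -> S (x + y).
Proof. by move=> Sx Sy; rewrite -(opprK y); apply/subring_setB/subring_setN. Qed.

Lemma subring_setMz x z : S x -> S (x *~ z).
Proof.
move=> Sx; have SMn n : S (x *+ n).
  by elim: n => [|n IHn]; rewrite ?mulrS; [exact: subring_set0 | exact: subring_setD].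
by case: z => n; rewrite ?NegzE ?mulrNz -!pmulrn //; apply: subring_setN.
Qed.

Lemma subring_setX x n : S x -> S (x ^+ n).
Proof.
move=> Sx; elim: n => [|n IHn]; first by rewrite expr0; exact: subring_set1.
by rewrite exprS; apply: subring_setM.
Qed.

End SubringSet.

Section OrderIntegrality.
Variables (a b : rat) (O : set (quat a b)).
Hypothesis ordO : is_order O.

(* The norms of the powers of x lie in O, so they have bounded denominators. *)
Lemma order_nrd_int x : O x -> nrd x \is a Num.int.
Proof.
case: (ordO) => subO [n [e OE]] _ Ox.
have [d1 d10 d1P] := fg_denominator (@q_1 _ a b) e.
have [d2 d20 d2P] := fg_denominator (@q_i _ a b) e.
have [d3 d30 d3P] := fg_denominator (@q_j _ a b) e.
have [d4 d40 d4P] := fg_denominator (@q_k _ a b) e.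
pose da := denq a; pose db := denq b.
apply: (@denominators_bounded_int _ ((d1 * d2 * d3 * d4) ^+ 2 * da * db)).
  apply: mulf_neq0; last exact: denq_neq0.
  apply: mulf_neq0; last exact: denq_neq0.
  by apply: expf_neq0; rewrite !mulf_eq0 !negb_or d10 d20 d30 d40.
move=> k; rewrite -nrdX.
have : O (x ^+ k) by apply: subring_setX.
move: (x ^+ k) => y; rewrite OE => -[c yE].
have := d1P c; have := d2P c; have := d3P c; have := d4P c; rewrite -yE.
set y1 := q_1 y; set y2 := q_i y; set y3 := q_j y; set y4 := q_k y => i4 i3 i2 i1.
have ia : a * da%:~R \is a Num.int by rewrite -numqE rpred_int.
have ib : b * db%:~R \is a Num.int by rewrite -numqE rpred_int.
rewrite /nrd (_ : _ * _ =
    (d1%:~R * y1) ^+ 2 * (d2 * d3 * d4)%:~R ^+ 2 * da%:~R * db%:~R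
  - (a * da%:~R) * ((d2%:~R * y2) ^+ 2 * (d1 * d3 * d4)%:~R ^+ 2 * db%:~R)
  - (b * db%:~R) * ((d3%:~R * y3) ^+ 2 * (d1 * d2 * d4)%:~R ^+ 2 * da%:~R)
  + (a * da%:~R) * (b * db%:~R) * ((d4%:~R * y4) ^+ 2 * (d1 * d2 * d3)%:~R ^+ 2)).
  move: i1 i2 i3 i4 ia ib.
  move: (d1%:~R * y1) (d2%:~R * y2) (d3%:~R * y3) (d4%:~R * y4) (a * _) (b * _).
  move=> u1 u2 u3 u4 ua ub i1 i2 i3 i4 ia ib.
  by rewrite ?(rpredD, rpredN, rpredM, rpredX, rpred_int).
by rewrite /y1 /y2 /y3 /y4; ring.
Qed.

(** [2 * q_1 x] is the reduced trace, recovered from the integral norms of [x] and [1 + x]. *)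
Lemma order_trd_int x : O x -> 2%:R * q_1 x \is a Num.int.
Proof.
move=> Ox; case: (ordO) => subO _ _.
have := order_nrd_int (subring_setD subO (subring_set1 subO) Ox).
rewrite nrd1D => h; rewrite (_ : _ * _ = (1 + 2%:R * q_1 x + nrd x) - 1 - nrd x); last by ring.
by rewrite !rpredB ?order_nrd_int.
Qed.

End OrderIntegrality.

Section IndexCauchy.
Variables (B : algType rat) (O M : set B) (N : nat).
Hypotheses (subO : GRing.subring_closed [in O]) (subM : GRing.subring_closed [in M]).
Hypothesis OM : has_index O M N.

(* Cauchy's theorem in M / O, realised by its translations of the index set 'I_N. *)
Lemma index_cauchy (q : nat) : prime q -> (q %| N)%N ->
  exists x, [/\ M x, ~ O x & O (x *+ q)].
Proof.
move=> q_pr qN; case: OM => r [Mr rP].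
have O0 := subring_set0 subO; have OB := subring_setB subO; have OD := subring_setD subO.
have MB := subring_setB subM; have MD := subring_setD subM.
have idx_ex x : exists i, M x -> O (x - r i).
  have [Mx|nMx] := pselect (M x); last by have [i _] := rP _ (subring_set0 subM); exists i.
  by have [i [Oi _]] := rP _ Mx; exists i.
pose idx x := projT1 (cid (idx_ex x)).
have idxP x : M x -> O (x - r (idx x)) by rewrite /idx; case: cid.
have idx_uniq x i : M x -> O (x - r i) -> i = idx x.
  move=> Mx Oi; have [k [_ kP]] := rP x Mx.
  by rewrite -(kP _ Oi) (kP _ (idxP _ Mx)).
have rO i k : O (r i - r k) -> i = k.
  move=> h; rewrite (idx_uniq (r i) i) ?subrr //.
  by rewrite -(idx_uniq (r i) k).
pose trans x (s : 'S_N) := forall i, O (r i + x - r (s i)).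
pose T := [set s : 'S_N | `[< exists2 x, M x & trans x s >]].
have TP s : s \in T -> exists2 x, M x & trans x s by rewrite finset.inE => /asboolP.
have T1 x : M x -> exists2 s, s \in T & trans x s.
  move=> Mx; have inj : injective (fun i => idx (r i + x)).
    move=> i k ik; apply: rO.
    have := OB _ _ (idxP _ (MD _ _ (Mr i) Mx)) (idxP _ (MD _ _ (Mr k) Mx)).
    by rewrite ik opprB addrA subrK opprD addrACA subrr addr0.
  have tr : trans x (perm inj) by move=> i; rewrite permE; apply/idxP/MD.
  by exists (perm inj) => //; rewrite finset.inE; apply/asboolP; exists x.
have transM x y s t : trans x s -> trans y t -> trans (x + y) (s * t)%g.
  move=> xs yt i; have := OD _ _ (xs i) (yt (s i)).
  by rewrite permM !addrA subrK.
have trans1 : trans 0 1%g by move=> i; rewrite perm1 addr0 subrr.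
have gT : group_set T.
  apply/group_setP; split.
    by rewrite finset.inE; apply/asboolP; exists 0 => //; exact: subring_set0.
  move=> s t /TP[x Mx xs] /TP[y My yt]; rewrite finset.inE; apply/asboolP.
  by exists (x + y); [exact: MD | exact: transM].
have [i0 _] := rP _ (subring_set0 subM).
(* A translation is determined by the image of one coset, and [r k - r i0] carries the coset of
   [r i0] to that of [r k]; hence [T] has exactly [N] elements. *)
have inj_ev : {in T &, injective (fun s : 'S_N => s i0)}.
  move=> s t /TP[x Mx xs] /TP[y My yt] st.
  have Oxy : O (x - y).
    have := OB _ _ (xs i0) (yt i0).
    by rewrite st opprB addrA subrK opprD addrACA subrr add0r.
  apply/permP => i; apply: rO; have := OB _ _ (OD _ _ (yt i) Oxy) (xs i).
  have -> : r i + y - r (t i) + (x - y) = r i + x - r (t i).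
    by rewrite addrACA [_ + y + x]addrAC [- _ - y]addrC addrA addrK.
  by rewrite opprB addrC addrA subrK.
have cardT : #|T| = N.
  rewrite -(card_in_imset inj_ev) -[RHS]card_ord; apply: eq_card => k.
  rewrite [RHS]finset.inE; apply/imsetP; have [s sT xs] := T1 _ (MB _ _ (Mr k) (Mr i0)).
  by exists s => //; apply: rO; have := xs i0; rewrite subrKC.
have [||s sT s_ord] := @Cauchy _ q (group gT); rewrite //= ?cardT //.
have [x Mx xs] := TP _ sT; exists x; split=> //.
- move=> Ox; have s1 : s = 1%g.
    apply: inj_ev => //; first exact: (group1 (group gT)).
    by rewrite perm1; apply: rO; have := OB _ _ Ox (xs i0); rewrite opprB addrC opprD addrA subrK.
  by move: s_ord q_pr; rewrite s1 order1 => <-.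
- have transX n : trans (x *+ n) (s ^+ n)%g.
    by elim: n => [|n IHn]; rewrite ?mulrSr ?expgSr //; exact: transM.
  by have := transX q i0; rewrite -s_ord expg_order perm1 addrAC subrr add0r.
Qed.

End IndexCauchy.

(** * From the embedding to the congruence conditions *)

Lemma square_free_logn (n p : nat) : (0 < n)%N -> square_free n ->
  prime p -> (p %| n)%N -> logn p n = 1%N.
Proof.
move=> n_gt0 sqf p_pr pn; apply/eqP.
rewrite eqn_leq logn_gt0 mem_primes p_pr n_gt0 pn andbT.
by rewrite leqNgt -pfactor_dvdn // (negPf (sqf p p_pr)).
Qed.

Lemma square_free_dvd_int (n : nat) (z : int) : (0 < n)%N -> square_free n ->
  (forall p, prime p -> (p %| n)%N -> (p %| z)%Z) -> (n %| z)%Z.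
Proof.
move=> n_gt0 sqf h; rewrite dvdzE /=; apply/dvdn_partP => // p.
rewrite mem_primes => /and3P[p_pr _ pn]; rewrite p_part.
by rewrite square_free_logn // expn1; exact: (h p p_pr pn).
Qed.

Lemma square_free_mul (m n : nat) : coprime m n ->
  square_free m -> square_free n -> square_free (m * n).
Proof.
move=> co sm sn p p_pr; have [pm|pm] := boolP (p %| m)%N.
  have pn : coprime (p ^ 2) n by rewrite coprimeXl // (coprime_dvdl pm).
  by rewrite Gauss_dvdl // sm.
by rewrite Gauss_dvdr ?sn // coprimeXl // prime_coprime.
Qed.

Lemma square_free_dvdn (m n : nat) : (m %| n)%N -> square_free n -> square_free m.
Proof. by move=> mn sn p p_pr; apply: contra (sn p p_pr) => pm; apply: dvdn_trans mn. Qed.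

Lemma q_1Z (F : fieldType) (a b c : F) (x : quat a b) : q_1 (c *: x) = c * q_1 x.
Proof. by []. Qed.

Lemma q_1D (F : fieldType) (a b : F) (x y : quat a b) : q_1 (x + y) = q_1 x + q_1 y.
Proof. by []. Qed.

Section Expansion.
Variables (F : fieldType) (a b : F) (w1 w2 : quat a b).
Hypotheses (w1_pure : q_1 w1 = 0) (w2_pure : q_1 w2 = 0).
Let s := nrd w1.
Let m := nrd w2.
Let u := q_1 (w1 * w2).

(* Expansion in the basis dual to 1, w1, w2, w1 w2 for the trace form. *)
Lemma quat_dual_expansion x :
  (s * m - u ^+ 2) *: x =
      ((s * m - u ^+ 2) * q_1 x - u * (u * q_1 x - q_1 (x * (w1 * w2))))%:A
    - (m * q_1 (x * w1) + u * q_1 (x * w2)) *: w1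
    - (u * q_1 (x * w1) + s * q_1 (x * w2)) *: w2
    + (u * q_1 x - q_1 (x * (w1 * w2))) *: (w1 * w2).
Proof.
rewrite /u /m /s /nrd; case: x w1 w2 w1_pure w2_pure => x1 xi xj xk.
move=> [v1 vi vj vk] [y1 yi yj yk] /= -> ->.
by apply: quatP => /=; ring.
Qed.

Lemma nrd_combination (e0 e1 e2 e3 : F) :
  nrd (e0%:A + e1 *: w1 + e2 *: w2 + e3 *: (w1 * w2)) =
  e0 ^+ 2 + s * e1 ^+ 2 + m * e2 ^+ 2 + s * m * e3 ^+ 2
    + 2%:R * u * (e0 * e3 - e1 * e2).
Proof.
rewrite /u /m /s /nrd; case: w1 w2 w1_pure w2_pure => v1 vi vj vk.
by move=> [y1 yi yj yk] /= -> ->; ring.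
Qed.

Lemma pure_sqr : w1 ^+ 2 = - s%:A.
Proof.
by rewrite /s /nrd; case: w1 w1_pure => v1 vi vj vk /= ->; apply: quatP => /=; ring.
Qed.

Lemma pure_anticomm : w1 * w2 = (2%:R * u)%:A - w2 * w1.
Proof.
rewrite /u; case: w1 w2 w1_pure w2_pure => v1 vi vj vk [y1 yi yj yk] /= -> ->.
by apply: quatP => /=; ring.
Qed.

End Expansion.

(** With a nonzero scalar part, vanishing of the imaginary part of the square would make [w] a
    rational number, whose square is not negative. *)
Lemma sqr_neg_pure (a b : rat) (n : nat) (w : quat a b) :
  (0 < n)%N -> w ^+ 2 = - n%:R -> q_1 w = 0 /\ nrd w = n%:R.
Proof.
move=> n_gt0; rewrite quat_natE expr2; case: w => w1 wi wj wk wE.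
have /= h1 := congr1 (@q_1 _ a b) wE; have /= hi := congr1 (@q_i _ a b) wE.
have /= hj := congr1 (@q_j _ a b) wE; have /= hk := congr1 (@q_k _ a b) wE.
have nQ : 0 < n%:R :> rat by rewrite ltr0n.
have [w10|w10] := eqVneq w1 0.
  by split; rewrite // /nrd /=; move: h1; rewrite w10 => h1; lra.
have z (y : rat) : 2%:R * w1 * y = 0 -> y = 0.
  by move/eqP; rewrite mulf_eq0 mulf_eq0 (negPf w10) => /eqP.
have wi0 : wi = 0 by apply: z; rewrite -[RHS]oppr0 -hi; ring.
have wj0 : wj = 0 by apply: z; rewrite -[RHS]oppr0 -hj; ring.
have wk0 : wk = 0 by apply: z; rewrite -[RHS]oppr0 -hk; ring.
by move: h1; rewrite wi0 wj0 wk0 => h1; nra.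
Qed.

(** * The suborder generated by omega and [w2] *)

Section EmbeddedOrder.
Variables (a b : rat) (w1 w2 : quat a b) (m : nat).
Hypotheses (m_gt0 : (0 < m)%N) (w1w1 : w1 ^+ 2 = - 3%:R) (w2w2 : w2 ^+ 2 = - m%:R).
Local Notation omega := (2%:R^-1 *: (1 + w1)).

Let pure1 : q_1 w1 = 0. Proof. by have [] := sqr_neg_pure (isT : 0 < 3)%N w1w1. Qed.
Let nrd1 : nrd w1 = 3%:R. Proof. by have [] := sqr_neg_pure (isT : 0 < 3)%N w1w1. Qed.
Let pure2 : q_1 w2 = 0. Proof. by have [] := sqr_neg_pure m_gt0 w2w2. Qed.
Let nrd2 : nrd w2 = m%:R. Proof. by have [] := sqr_neg_pure m_gt0 w2w2. Qed.

(** Since [w2] has trace zero, [q_1 (w1 * w2)] is the reduced trace of [omega * w2]. *)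
Lemma embedded_trace_int (M : set (quat a b)) : is_order M -> M omega -> M w2 ->
  exists u : int, q_1 (w1 * w2) = u%:~R.
Proof.
move=> ordM Mo Mw; case: (ordM) => subM _ _.
have := order_trd_int ordM (subring_setM subM Mo Mw).
move=> /intrP[u uE]; exists u; rewrite -uE -scalerAl q_1Z mulrA divff // mul1r.
by rewrite mulrDl mul1r q_1D pure2 add0r.
Qed.

Variable u : int.
Hypothesis uE : q_1 (w1 * w2) = u%:~R.
Let Delta : int := 3 * m%:Z - u ^+ 2.

Lemma embedded_split (F : fieldType) (alpha beta : F) : [pchar F] =i pred0 ->
  Delta != 0 -> alpha ^+ 2 + 3%:R * beta ^+ 2 + Delta%:~R = 0 ->
  ~ division_ring (quat (ratr a : F) (ratr b)).
Proof.
(* [j] is 3 times the component of [w2] orthogonal to [w1], so it anticommutes with [w1]; its norm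
   is [3 * Delta]. Multiplying a representation of [- Delta] by 3 exchanges the roles of [alpha] and
   [beta]. *)
move=> F0 D0 ab; pose j := 3%:R *: w2 + u%:~R *: w1.
have jp : q_1 j = 0 by rewrite /j /= pure1 pure2 !mulr0 addr0.
have DE : Delta%:~R = 3%:R * m%:R - u%:~R ^+ 2 :> rat.
  by rewrite /Delta rmorphB rmorphM rmorphXn.
have jn : nrd j = 3%:R * Delta%:~R.
  have := @nrd_combination _ _ _ _ _ pure1 pure2 0 u%:~R 3%:R 0.
  rewrite scale0r add0r scale0r addr0 [_ *: w1 + _]addrC -/j => ->.
  by rewrite uE nrd1 nrd2 DE; ring.
apply: (@quat_ext_split F F0 a b w1 j (3%:R * Delta%:~R) (3%:R * beta) alpha) => //.
- by rewrite (pure_sqr jp) jn.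
- rewrite (pure_anticomm pure1 jp) (_ : q_1 (w1 * j) = 0) ?mulr0 ?scale0r ?add0r //.
  rewrite /j mulrDr -!scalerAr q_1D !q_1Z uE -expr2 (pure_sqr pure1) nrd1 /=.
  by ring.
- by rewrite mulf_neq0 // intr_eq0.
- rewrite rmorphM rmorph_nat rmorph_int.
  by transitivity (3%:R * (alpha ^+ 2 + 3%:R * beta ^+ 2 + Delta%:~R)); [ring | rewrite ab mulr0].
Qed.

Lemma nrd_omega_basis (c0 c1 c2 c3 : rat) : u = 0 ->
  nrd (c0%:A + c1 *: omega + c2 *: w2 + c3 *: (omega * w2)) =
  qform m%:R c0 c1 c2 c3.
Proof.
move=> u0; have -> : c0%:A + c1 *: omega + c2 *: w2 + c3 *: (omega * w2) =
    (c0 + c1 / 2%:R)%:A + (c1 / 2%:R) *: w1 + (c2 + c3 / 2%:R) *: w2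
    + (c3 / 2%:R) *: (w1 * w2).
  by case: w1 w2 => [v1 vi vj vk] [y1 yi yj yk]; apply: quatP => /=; field.
by rewrite nrd_combination // uE u0 nrd1 nrd2 /qform; field.
Qed.

(** The traces of [x] against the basis 1, omega, [w2], omega [w2] are integers, so [Delta]
    annihilates the quotient of [M] by the suborder. The norm clause feeds the argument at inert
    primes. *)
Lemma embedded_dual (M : set (quat a b)) x :
  is_order M -> M omega -> M w2 -> M x ->
  exists n0 n1 n2 n3 : int,
    Delta%:~R *: x = n0%:~R%:A + n1%:~R *: omega + n2%:~R *: w2 + n3%:~R *: (omega * w2)
    /\ (u = 0 -> (qform m%:Z n0 n1 n2 n3)%:~R = Delta%:~R ^+ 2 * nrd x).
Proof.
move=> ordM Mo Mw Mx; case: (ordM) => subM _ _; have MM := subring_setM subM.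
have /intrP[t0 t0E] := order_trd_int ordM Mx.
have /intrP[t1 t1E] := order_trd_int ordM (MM _ _ Mx Mo).
have /intrP[t2 t2E] := order_trd_int ordM (MM _ _ Mx Mw).
have /intrP[t3 t3E] := order_trd_int ordM (MM _ _ Mx (MM _ _ Mo Mw)).
have two : 2%:R != 0 :> rat by [].
have r0 : q_1 x = t0%:~R / 2%:R by rewrite -t0E mulrC mulKf.
have r2 : q_1 (x * w2) = t2%:~R / 2%:R by rewrite -t2E mulrC mulKf.
have half y : 2%:R * q_1 (x * (2%:R^-1 *: y)) = q_1 (x * y).
  by rewrite -[x * _]scalerAr q_1Z mulrA divff // mul1r.
have r1 : q_1 (x * w1) = t1%:~R - t0%:~R / 2%:R.
  by rewrite -t1E -r0 half [x * (1 + w1)]mulrDr mulr1 q_1D addrC addKr.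
have r3 : q_1 (x * (w1 * w2)) = t3%:~R - t2%:~R / 2%:R.
  rewrite -t3E -r2 -[omega * w2]scalerAl half [(1 + w1) * w2]mulrDl mul1r.
  by rewrite [x * (w2 + _)]mulrDr q_1D addrC addKr.
pose M' : int := m%:Z.
(* The coefficients of [quat_dual_expansion], rewritten in the basis containing omega. *)
exists (t0 * (M' - u ^+ 2) + u * t3 + M' * t1), (M' * t0 - 2 * M' * t1 - u * t2).
exists (t3 - u * t1 - 2 * t2), (u * t0 - 2 * t3 + t2).
have DE : Delta%:~R = 3%:R * m%:R - u%:~R ^+ 2 :> rat.
  by rewrite /Delta rmorphB rmorphM rmorphXn.
have xE : Delta%:~R *: x =
   (t0 * (M' - u ^+ 2) + u * t3 + M' * t1)%:~R%:A
   + (M' * t0 - 2 * M' * t1 - u * t2)%:~R *: omega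
   + (t3 - u * t1 - 2 * t2)%:~R *: w2
   + (u * t0 - 2 * t3 + t2)%:~R *: (omega * w2).
  have := quat_dual_expansion pure1 pure2 x; rewrite uE nrd1 nrd2 -DE => ->.
  rewrite r0 r1 r2 r3 DE !(rmorphD, rmorphB, rmorphM, rmorphXn) /= -!pmulrn.
  by case: w1 w2 => [v1 vi vj vk] [y1 yi yj yk]; apply: quatP => /=; field.
split=> [|u0]; first by exact: xE.
transitivity (nrd (Delta%:~R *: x)); last by rewrite /nrd /=; ring.
rewrite xE nrd_omega_basis // /qform !(rmorphD, rmorphM, rmorphXn) /= -!pmulrn.
by [].
Qed.

End EmbeddedOrder.

Lemma dvdz_prime_exp2 (p : nat) (z : int) : prime p -> (p %| z ^+ 2)%Z = (p %| z)%Z.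
Proof. by move=> p_pr; rewrite expr2 prime_dvdz_mul // orbb. Qed.

(** * Divisors of [Delta] and the congruences on the primes of [D] and [N] *)

Section Necessity.
Variables (R : realType) (D N m : nat).
Hypotheses (D_gt0 : (0 < D)%N) (N_gt0 : (0 < N)%N) (coDN : coprime D N).
Hypotheses (D_sqf : square_free D) (N_sqf : square_free N) (D_odd : odd (size (primes D))).
Hypotheses (m_dvd : (m %| D * N)%N) (m_gt1 : (1 < m)%N) (m_neq3 : m <> 3%N).
Variables (a b : rat) (O M : set (quat a b)) (w1 w2 : quat a b).
Hypotheses (def_ab : definite R a b) (disc_ab : has_discriminant a b D).
Hypotheses (ordM : is_order M) (subO : GRing.subring_closed [in O]).
Hypotheses (OM : (O `<=` M)%classic) (idxOM : has_index O M N).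
Hypotheses (w1w1 : w1 ^+ 2 = - 3%:R) (w2w2 : w2 ^+ 2 = - m%:R).
Hypotheses (Oo : O (2%:R^-1 *: (1 + w1))) (Ow2 : O w2).

Lemma necessity :
  [/\ m = (D * N)%N \/ ((3 %| D * N)%N /\ m = (D * N %/ 3)%N),
      forall p : nat, prime p -> (p %| D)%N -> p = 3%N \/ p = 2 %[mod 3]
    & forall q : nat, prime q -> (q %| N)%N -> q = 3%N \/ q = 1 %[mod 3]].
Proof.
have m_gt0 : (0 < m)%N by exact: ltnW.
have DN_sqf := square_free_mul coDN D_sqf N_sqf.
have m_sqf := square_free_dvdn m_dvd DN_sqf.
have Mo := OM Oo; have Mw2 := OM Ow2; case: (ordM) => subM _ _.
have [u uE] := embedded_trace_int m_gt0 w2w2 ordM Mo Mw2.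
pose Delta : int := 3 * m%:Z - u ^+ 2.
(* Square-freeness forces k^2 = 1, hence m = 3. This excludes [Delta = 0], where u = 3k. *)
have m3k (k : int) : m%:Z = 3 * k ^+ 2 -> False.
  move=> mE; case: m_neq3; have mkE : m = (3 * `|k| ^ 2)%N by move: mE; lia.
  have [k1|k1] := eqVneq `|k|%N 1%N; first by rewrite mkE k1.
  have k2 : (1 < `|k|)%N by move: k1 m_gt0; rewrite mkE; case: `|k|%N => [|[]].
  have := m_sqf _ (pdiv_prime k2); rewrite mkE dvdn_mull //.
  by rewrite dvdn_exp2r // pdiv_dvd.
have D0 : Delta != 0.
  apply/eqP => D0; have u3 : (3 %| u)%Z.
    rewrite -dvdz_prime_exp2 // (_ : u ^+ 2 = 3 * m%:Z) ?dvdz_mulr //.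
    by move: D0; rewrite /Delta; lia.
  case/dvdzP: u3 => k kE; apply: (m3k k).
  by move: D0; rewrite /Delta kE; nia.
(* Otherwise [- Delta] is a square in R and the algebra splits there, against definiteness. *)
have D_pos : 0 < Delta.
  rewrite lt_neqAle eq_sym D0 /= leNgt; apply/negP => D_neg.
  apply: (@embedded_split _ _ _ _ _ m_gt0 w1w1 w2w2 _ uE R
    (Num.sqrt (- Delta%:~R)) 0 (pchar_num _) D0 _ def_ab).
  by rewrite sqr_sqrtr ?expr0n ?mulr0 ?addr0 ?addNr // oppr_ge0 -(rmorph0 intr) ler_int ltW.
have D_prime p : prime p -> (p %| D)%N -> (p %| Delta)%Z /\ (p = 3%N \/ p = 2 %[mod 3]).
  move=> p_pr pD; have [s [_ sP DE]] := disc_ab.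
  have ps : p \in s.
    move: pD; rewrite DE Euclid_dvd_prod // big_has => /hasP[q qs pq].
    have [q_pr _] := (sP q).1 qs.
    by move: pq; rewrite /= dvdn_prime2 // => /eqP->.
  have [p_pr' div_p] := (sP p).1 ps.
  have not_rep : ~ [\/ p != 3%N /\ ~~ (p %| Delta)%Z, (p %% 3 = 1)%N
      | p = 3%N /\ (3 %| Delta + 1)%Z].
    move=> /(padic_norm_rep p_pr')[alpha [beta ab]].
    exact: (embedded_split m_gt0 w1w1 w2w2 uE (padic_pchar p_pr') D0 ab).
  have [p3|p3] := eqVneq p 3%N.
    split; last by left.
    (* If 3 does not divide [Delta], it does not divide [u], and [Delta] is - u^2 = -1 modulo 3: the
       third case of [padic_norm_rep]. *)
    rewrite p3; apply: contra_notT not_rep => nD; apply: Or33; split=> //.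
    have u3 : ~~ (3 %| u)%Z.
      apply: contra nD => /dvdzP[k kE]; rewrite /Delta kE.
      rewrite (_ : _ - _ = (m%:Z - 3 * k ^+ 2) * 3); last by ring.
      by rewrite dvdz_mull.
    have [q [r [uqr hr]]] : exists q r : int, u = q * 3 + r /\ (r = 1 \/ r = -1).
      by exists ((u + 1) %/ 3)%Z, (u - ((u + 1) %/ 3)%Z * 3); lia.
    rewrite /Delta uqr.
    rewrite (_ : _ + 1 = (m%:Z - 3 * q ^+ 2 - 2 * q * r) * 3 + (1 - r ^+ 2)); last by ring.
    by case: hr => ->; rewrite rpredD ?dvdz_mull.
  split.
    by apply: contra_notT not_rep => nD; apply: Or31.
  right; have p31 : (p %% 3 <> 1)%N by move=> h; apply: not_rep; apply: Or32.
  have p30 : (p %% 3 <> 0)%N.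
    move=> h; case/eqP: p3; apply/esym/eqP; rewrite -(dvdn_prime2 _ p_pr) //.
    by rewrite /dvdn h.
  by have := ltn_pmod p (isT : 0 < 3)%N; lia.
have combo (n0 n1 n2 n3 : int) : O (n0%:~R%:A + n1%:~R *: (2%:R^-1 *: (1 + w1)) + n2%:~R *: w2 +
      n3%:~R *: ((2%:R^-1 *: (1 + w1)) * w2)).
  rewrite !scaler_int; have OD := subring_setD subO; have OZ := subring_setMz subO.
  apply: (OD); last by apply: (OZ); exact: (subring_setM subO).
  apply: (OD); last exact: (OZ).
  by apply: (OD); [apply: (OZ); exact: (subring_set1 subO) | exact: (OZ)].
have bezout (q : nat) (k : int) x : prime q -> ~~ (q %| k)%Z -> O (x *+ q) -> O (k%:~R *: x) -> O x.
  move=> q_pr qk Oq Ok; have : coprimez q k by rewrite coprimezE prime_coprime.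
  case/coprimezP => -[e f] /= ef.
  have -> : x = (x *+ q) *~ e + (k%:~R *: x) *~ f.
    by rewrite scaler_int -!mulrzA pmulrn -mulrzA -mulrzDr mulrC [k * f]mulrC ef mulr1z.
  by apply: (subring_setD subO); apply: (subring_setMz subO).
(* The quotient of [M] by [O] has an element of order [q] and is annihilated by [Delta], which
   therefore cannot be prime to [q]. *)
have N_prime q : prime q -> (q %| N)%N -> (q %| Delta)%Z.
  move=> q_pr qN; have [x [Mx nOx Oqx]] := index_cauchy subO subM idxOM q_pr qN.
  apply: contra_notT nOx => qD; apply: (bezout q Delta) => //.
  have [n0 [n1 [n2 [n3 [-> _]]]]] := embedded_dual m_gt0 w1w1 w2w2 uE ordM Mo Mw2 Mx.
  exact: combo.
have DN_dvd : (D * N %| Delta)%Z.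
  rewrite dvdzE /= Gauss_dvd //; apply/andP; split.
    by apply: (@square_free_dvd_int D Delta) => // p p_pr /(D_prime p p_pr)[].
  by apply: (@square_free_dvd_int N Delta).
have m_dvd_u : (m%:Z %| u)%Z.
  apply: square_free_dvd_int => // p p_pr pm; rewrite -dvdz_prime_exp2 //.
  rewrite (_ : u ^+ 2 = 3 * m%:Z - Delta); last by rewrite /Delta; ring.
  rewrite rpredB ?dvdz_mull //; apply: dvdz_trans DN_dvd.
  by rewrite dvdzE /=; apply: dvdn_trans m_dvd.
have small_u : u = 0 \/ m = 2%N /\ u ^+ 2 = 4.
  case/dvdzP: m_dvd_u => v uv; move: D_pos; rewrite /Delta uv => D_pos.
  have [->|v0] := eqVneq v 0; first by left; rewrite mul0r.
  have v1 : 1 <= v ^+ 2 by rewrite -gtz0_ge1 exprn_even_gt0.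
  have mZ : 0 < m%:Z by [].
  have m_lt3 : m%:Z * v ^+ 2 < 3.
    move: D_pos; rewrite (_ : _ - _ = m%:Z * (3 - m%:Z * v ^+ 2)); last by ring.
    by rewrite pmulr_rgt0 // subr_gt0.
  have m_le : m%:Z * 1 <= m%:Z * v ^+ 2 by rewrite ler_pM2l.
  have m2 : m = 2%N by move: (v ^+ 2) m_lt3 m_le; lia.
  right; split=> //; rewrite exprMn m2; rewrite m2 in m_lt3.
  by move: (v ^+ 2) m_lt3 v1 => V hV V1; have -> : V = 1 by lia.
(* In the exceptional case [Delta] is 6 - 4 = 2, which forces [D * N = 2]; [D = 1] is excluded
   because its number of prime factors is even. *)
case: small_u => [u0|[m2 u2]]; last first.
  have DE : Delta = 2 by rewrite /Delta m2 u2.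
  have DN2 : (D * N)%N = 2%N.
    have : (D * N %| 2)%N by move: DN_dvd; rewrite DE.
    by move/(dvdn_leq (isT : 0 < 2)%N) => h; have := dvdn_leq _ m_dvd; rewrite m2; lia.
  have D2 : D = 2%N.
    have : (D %| 2)%N by rewrite -DN2 dvdn_mulr.
    by move/(dvdn_leq (isT : 0 < 2)%N); case: (D) D_gt0 D_odd => [|[|[|]]].
  have N1 : N = 1%N by move: DN2; rewrite D2; lia.
  split; first by left; rewrite m2 DN2.
    by move=> p p_pr /(D_prime p p_pr)[].
  by move=> q q_pr; rewrite N1 dvdn1 => /eqP q1; rewrite q1 in q_pr.
have DE : Delta = 3 * m%:Z by rewrite /Delta u0; ring.
split.
(* [D * N] equals [k * m] and divides [Delta = 3 * m], so [k] is 1 or 3. *)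
- have [k kE] := dvdnP m_dvd.
  have k3 : (k %| 3)%N.
    have : (D * N %| 3 * m)%N by move: DN_dvd; rewrite DE.
    by rewrite kE dvdn_pmul2r.
  have := dvdn_leq (isT : 0 < 3)%N k3.
  case: k kE k3 => [|[|[|[|]]]] // kE _ _; first by left; rewrite kE mul1n.
  by right; rewrite kE dvdn_mulr // mulKn.
- by move=> p p_pr /(D_prime p p_pr)[].
move=> q q_pr qN; have [->|q3] := eqVneq q 3%N; [by left | right].
have q30 : (q %% 3 <> 0)%N.
  move=> h; case/eqP: q3; apply/esym/eqP; rewrite -(dvdn_prime2 _ q_pr) //.
  by rewrite /dvdn h.
suff : (q %% 3 <> 2)%N.
  by move: (q %% 3)%N q30 (ltn_pmod q (isT : 0 < 3)%N) => [|[|[|]]].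
(* The norm of [Delta *: x] is divisible by q^2, so its coordinates are divisible by [q]. Hence
   [Delta / q = 3 * m'] already carries [x] into [O]; being prime to [q], it kills the [q]-torsion
   class of [x]. *)
move=> q2; have [x [Mx nOx Oqx]] := index_cauchy subO subM idxOM q_pr qN; apply: nOx.
have q3z : ~~ (q %| (3%:R : int))%Z.
  by apply: contra q3 => q_3; rewrite -(dvdn_prime2 q_pr).
have qm : (q %| m%:Z)%Z.
  by have := N_prime q q_pr qN; rewrite DE prime_dvdz_mul // (negPf q3z).
have qqm : ~~ (q%:Z ^+ 2 %| m%:Z)%Z by rewrite dvdzE abszX m_sqf.
have [n0 [n1 [n2 [n3 [xE /(_ u0) QE]]]]] := embedded_dual m_gt0 w1w1 w2w2 uE ordM Mo Mw2 Mx.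
rewrite -/Delta in xE QE.
have /dvdzP[m' mE] := qm.
have /intrP[nx nxE] := order_nrd_int ordM Mx.
have [|/dvdzP[k0 k0E] /dvdzP[k1 k1E] /dvdzP[k2 k2E] /dvdzP[k3 k3E]] :=
  @quaternary_inert_dvd q q_pr m%:Z n0 n1 n2 n3 q2 qm qqm.
  rewrite -/(qform m%:Z n0 n1 n2 n3); apply/dvdzP; exists ((3 * m') ^+ 2 * nx).
  apply/eqP; rewrite -(eqr_int rat) QE nxE DE mE !(rmorphM, rmorphXn) /=; apply/eqP; ring.
apply: (bezout q (3 * m')) => //.
  rewrite prime_dvdz_mul // (negPf q3z) /=; apply: contra qqm => /dvdzP[m'' m''E].
  by rewrite mE m''E -mulrA -expr2 dvdz_mull.
have q0 : q%:Z%:~R != 0 :> rat by rewrite intr_eq0 -lt0n prime_gt0.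
suff -> : (3 * m')%:~R *: x = k0%:~R%:A + k1%:~R *: (2%:R^-1 *: (1 + w1)) +
  k2%:~R *: w2 + k3%:~R *: ((2%:R^-1 *: (1 + w1)) * w2) by exact: combo.
apply: (scalerI q0); rewrite scalerA -rmorphM /= (_ : q%:Z * (3 * m') = Delta).
  have scaleq (k : int) (v : quat a b) : (k * q%:Z)%:~R *: v = q%:Z%:~R *: (k%:~R *: v).
    by rewrite scalerA -rmorphM mulrC.
  by rewrite xE k0E k1E k2E k3E !scaleq -!scalerDr.
by rewrite DE mE; ring.
Qed.

End Necessity.

(** * The lattices M(t, e) and their maximality *)

Section Lattice.
Variables (m t e K : int).
Local Notation B := (quat (- 3%:R : rat) (- m%:~R)).
Local Notation T := (t%:~R : rat).
Local Notation e' := (e%:~R : rat).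
Local Notation K' := (K%:~R : rat).
Implicit Types (x y : B).

(* c0 + c1 omega + c2 j + c3 (omega - t)(j + e) / K, where omega = (1 + i) / 2. *)
Definition lat_elem (c0 c1 c2 c3 : rat) : B :=
  Quat _ _ (c0 + c1 / 2%:R + c3 * (e' / 2%:R - T * e') / K')
    (c1 / 2%:R + c3 * e' / (2%:R * K'))
    (c2 + c3 * (1 / 2%:R - T) / K') (c3 / (2%:R * K')).

Definition lattice : set B :=
  [set x | exists c0 c1 c2 c3 : int, x = lat_elem c0%:~R c1%:~R c2%:~R c3%:~R]%classic.

Lemma lat_elemB c0 c1 c2 c3 d0 d1 d2 d3 :
  lat_elem c0 c1 c2 c3 - lat_elem d0 d1 d2 d3 =
  lat_elem (c0 - d0) (c1 - d1) (c2 - d2) (c3 - d3).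
Proof. by apply: quatP => /=; ring. Qed.

Hypothesis K0 : K != 0.
Let K0' : K' != 0. Proof. by rewrite intr_eq0. Qed.

Lemma lat_elem_surj x : exists c0 c1 c2 c3, x = lat_elem c0 c1 c2 c3.
Proof.
case: x => x1 xi xj xk; exists (x1 - xi + 2%:R * T * e' * xk), (2%:R * xi - 2%:R * e' * xk).
exists (xj - xk + 2%:R * T * xk), (2%:R * K' * xk).
by apply: quatP => /=; field.
Qed.

(** The arguments of [qform] are the coordinates of [K] times the element in the basis 1, omega, j,
    omega j. *)
Lemma nrd_lat_elem (c0 c1 c2 c3 : rat) : K' ^+ 2 * nrd (lat_elem c0 c1 c2 c3) =
  qform m%:~R (K' * c0 - T * e' * c3) (K' * c1 + e' * c3) (K' * c2 - T * c3) c3.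
Proof. by rewrite /nrd /qform /=; field. Qed.

Variables (A E F G : int).
Hypotheses (AE : K * A = t ^+ 2 - t + 1) (EE : K * E = e ^+ 2 + m).
Hypotheses (FE : K * F = e * (2 * t - 1)) (GE : K * G = e * (2 - t)).

Let A' : A%:~R = (T ^+ 2 - T + 1) / K' :> rat.
Proof.
apply: (mulfI K0'); rewrite [RHS]mulrC divfK // -rmorphM /= AE.
by rewrite rmorphD rmorphB rmorphXn.
Qed.
Let E' : E%:~R = (e' ^+ 2 + m%:~R) / K' :> rat.
Proof.
apply: (mulfI K0'); rewrite [RHS]mulrC divfK // -rmorphM /= EE.
by rewrite rmorphD rmorphXn.
Qed.
Let F' : F%:~R = e' * (2%:R * T - 1) / K' :> rat.
Proof.
apply: (mulfI K0'); rewrite [RHS]mulrC divfK // -rmorphM /= FE.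
by rewrite rmorphM rmorphB rmorphM.
Qed.
Let G' : G%:~R = e' * (2%:R - T) / K' :> rat.
Proof.
apply: (mulfI K0'); rewrite [RHS]mulrC divfK // -rmorphM /= GE.
by rewrite rmorphM rmorphB.
Qed.

(** [K * A] and [K * E] are the norms of omega - t and j + e, and [- F] is the trace of the fourth
    basis vector. With [G] these integers express the structure constants; the witnesses are the
    coordinates of the product. *)
Lemma lattice_mul x y : lattice x -> lattice y -> lattice (x * y).
Proof.
move=> [c0 [c1 [c2 [c3 ->]]]] [d0 [d1 [d2 [d3 ->]]]].
exists (c0 * d0 - c1 * d1 + t * e * c1 * d2 - A * e * c1 * d3 - t * e * c2 * d1
        - m * c2 * d2 - (F * e + E * (1 - t)) * c2 * d3 + (A * e - G) * c3 * d1
        + E * t * c3 * d2 - A * E * c3 * d3).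
exists (c0 * d1 + c1 * d0 + c1 * d1 - e * c1 * d2 + e * c2 * d1 + E * c2 * d3
        - F * c3 * d1 - E * c3 * d2).
exists (c0 * d2 + c2 * d0 + t * c1 * d2 - A * c1 * d3 + (1 - t) * c2 * d1
        - F * c2 * d3 + A * c3 * d1).
exists (c0 * d3 + c3 * d0 + K * c1 * d2 + (1 - t) * c1 * d3 - K * c2 * d1
        - e * c2 * d3 + t * c3 * d1 + e * c3 * d2 - F * c3 * d3).
rewrite !(rmorphD, rmorphN, rmorphM) /= A' E' F' G'.
by apply: quatP => /=; field.
Qed.

Lemma lattice_order : is_order lattice.
Proof.
split.
- split; first by apply: mem_set; exists 1, 0, 0, 0; apply: quatP => /=; field.
    move=> x y /set_mem[c0 [c1 [c2 [c3 ->]]]] /set_mem[d0 [d1 [d2 [d3 ->]]]]; apply: mem_set.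
    exists (c0 - d0), (c1 - d1), (c2 - d2), (c3 - d3).
    by rewrite lat_elemB !rmorphB.
  by move=> x y /set_mem Lx /set_mem Ly; apply/mem_set/lattice_mul.
- pose v (i : 'I_4) := lat_elem (i == 0 :> nat)%:R (i == 1 :> nat)%:R
    (i == 2 :> nat)%:R (i == 3 :> nat)%:R.
  exists 4%N, v; apply/seteqP; split=> x /=.
    move=> [c0 [c1 [c2 [c3 ->]]]]; exists (fun i => nth 0 [:: c0; c1; c2; c3] i).
    by rewrite !big_ord_recl big_ord0 /= -!scaler_int; apply: quatP => /=; field.
  move=> [c ->]; exists (c 0), (c 1), (c (inord 2)), (c (inord 3)).
  have -> : inord 2 = lift 0 (lift 0 0) :> 'I_4 by apply: val_inj; rewrite /= inordK.
  have -> : inord 3 = lift 0 (lift 0 (lift 0 0)) :> 'I_4 by apply: val_inj; rewrite /= inordK.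
  have -> : 1 = lift 0 0 :> 'I_4 by apply: val_inj.
  by rewrite !big_ord_recl big_ord0 /= -!scaler_int; apply: quatP => /=; field.
move=> x; have [c0 [c1 [c2 [c3 ->]]]] := lat_elem_surj x.
pose v (i : 'I_4) := lat_elem (i == 0 :> nat)%:R (i == 1 :> nat)%:R
    (i == 2 :> nat)%:R (i == 3 :> nat)%:R.
exists 4%N, v, (fun i => nth 0 [:: c0; c1; c2; c3] i); split.
  move=> i; exists (i == 0 :> nat)%:Z, (i == 1 :> nat)%:Z, (i == 2 :> nat)%:Z, (i == 3 :> nat)%:Z.
  by rewrite -!pmulrn.
by rewrite !big_ord_recl big_ord0 /=; apply: quatP => /=; field.
Qed.

Variable D : nat.
Hypotheses (DE : D%:Z * K = 3 * m) (D_gt0 : (0 < D)%N) (coDK : coprimez D K).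
Hypothesis D_aniso : forall p, prime p -> (p %| D)%N -> strongly_anisotropic p m.

Let m' : m%:~R = D%:R * K' / 3%:R :> rat.
Proof.
apply: (mulfI (isT : 3%:R != 0 :> rat)); rewrite [RHS]mulrC divfK //.
by rewrite [D%:R]pmulrn -rmorphM /= DE rmorphM.
Qed.

(* D times the coordinates of an integral x are integral, because D times the dual
   lattice for the trace form lies in the lattice; the local factors of D are then
   removed one by one using that nrd x is an integer. *)
Lemma lattice_maximal : maximal_order lattice.
Proof.
split=> [|M ordM LM]; first exact: lattice_order.
apply/seteqP; split=> // x Mx.
have [c0 [c1 [c2 [c3 xE]]]] := lat_elem_surj x.
have Mb (d0 d1 d2 d3 : int) : M (lat_elem d0%:~R d1%:~R d2%:~R d3%:~R).
  by apply: LM; exists d0, d1, d2, d3.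
case: (ordM) => subM _ _; have MM := subring_setM subM.
have /intrP[t0 t0E] := order_trd_int ordM Mx.
have /intrP[t1 t1E] := order_trd_int ordM (MM _ _ Mx (Mb 0 1 0 0)).
have /intrP[t2 t2E] := order_trd_int ordM (MM _ _ Mx (Mb 0 0 1 0)).
have /intrP[t3 t3E] := order_trd_int ordM (MM _ _ Mx (Mb 0 0 0 1)).
have /intrP[n nE] := order_nrd_int ordM Mx.
have integral_coords : exists d0 d1 d2 d3 : int,
    [/\ D%:R * c0 = d0%:~R, D%:R * c1 = d1%:~R, D%:R * c2 = d2%:~R & D%:R * c3 = d3%:~R].
  (* [t0], [s1], [s2], [s3] are the traces of [x] against the conjugates of the basis vectors, and
     the coefficients below form [D] times the inverse Gram matrix. *)
  pose s1 := t0 - t1; pose s2 := - t2; pose s3 := - F * t0 - t3.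
  exists ((t * F * e - e * G + 2 * E) * t0 + (- e * F - E) * s1 + t * F * s2 + 2 * t * e * s3).
  exists ((- E - F * e) * t0 + 2 * E * s1 - F * s2 - 2 * e * s3).
  exists ((2 * A * e - G) * t0 - F * s1 + 2 * A * s2 + (2 * t - 1) * s3).
  exists (2 * K * s3 + 2 * t * e * t0 - 2 * e * s1 + (2 * t - 1) * s2).
  rewrite /s1 /s2 /s3 !(rmorphD, rmorphN, rmorphM) /= -t0E -t1E -t2E -t3E.
  rewrite A' E' F' G' xE /= m'.
  by split; field.
suff {integral_coords} descend d : (0 < d)%N -> (d %| D)%N ->
    (exists d0 d1 d2 d3 : int, [/\ d%:R * c0 = d0%:~R, d%:R * c1 = d1%:~R,
      d%:R * c2 = d2%:~R & d%:R * c3 = d3%:~R]) -> lattice x.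
  exact: (descend D).
have [l] := ubnP d; elim: l d => // l IHl d; rewrite ltnS => le_dl d_gt0 dD.
move=> [d0 [d1 [d2 [d3 [h0 h1 h2 h3]]]]].
have [d1E|d_neq1] := eqVneq d 1%N.
  exists d0, d1, d2, d3; rewrite xE -h0 -h1 -h2 -h3 d1E.
  by rewrite !mul1r.
have d_gt1 : (1 < d)%N by lia.
pose p := pdiv d; have p_pr : prime p by exact: pdiv_prime.
have pd : (p %| d)%N by exact: pdiv_dvd.
have /dvdnP[d' d'E] := pd.
have pD := dvdn_trans pd dD.
have pK : ~~ (p %| K)%Z.
  apply/negP => pK; have : (p%:Z %| gcdz D K)%Z by rewrite dvdz_gcd pK andbT.
  by rewrite (eqP coDK) dvdz1 /= => /eqP p1; rewrite p1 in p_pr.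
have [|p0 p1 p2 p3] :=
  @D_aniso p p_pr pD (K * d0 - t * e * d3) (K * d1 + e * d3) (K * d2 - t * d3) d3.
  apply/dvdzP; exists (d'%:Z ^+ 2 * K ^+ 2 * n); apply/eqP; rewrite -(eqr_int rat); apply/eqP.
  rewrite /qform !(rmorphD, rmorphN, rmorphM, rmorphXn) /= -h0 -h1 -h2 -h3 -nE xE.
  rewrite d'E -!pmulrn natrM.
  transitivity (d'%:R ^+ 2 * p%:R ^+ 2 * (K' ^+ 2 * nrd (lat_elem c0 c1 c2 c3))); last by ring.
  by rewrite nrd_lat_elem /qform; ring.
have pdiv3 : (p %| d3)%Z by [].
have pdiv0 : (p %| d0)%Z.
  have : (p %| K * d0)%Z; last by rewrite prime_dvdz_mul // (negPf pK).
  by rewrite -(subrK (t * e * d3) (K * d0)) rpredD ?dvdz_mull.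
have pdiv1 : (p %| d1)%Z.
  have : (p %| K * d1)%Z; last by rewrite prime_dvdz_mul // (negPf pK).
  by rewrite -(addrK (e * d3) (K * d1)) rpredB ?dvdz_mull.
have pdiv2 : (p %| d2)%Z.
  have : (p %| K * d2)%Z; last by rewrite prime_dvdz_mul // (negPf pK).
  by rewrite -(subrK (t * d3) (K * d2)) rpredD ?dvdz_mull.
have pQ : p%:R != 0 :> rat by rewrite pnatr_eq0 -lt0n prime_gt0.
have div_p (c : rat) (k : int) : d%:R * c = k%:~R -> (p %| k)%Z ->
    exists k' : int, d'%:R * c = k'%:~R.
  move=> hc /dvdzP[k' k'E]; exists k'; apply: (mulfI pQ).
  by rewrite mulrA -natrM mulnC -d'E hc k'E rmorphM /= mulrC.
have d'_gt0 : (0 < d')%N by move: d_gt0; rewrite d'E muln_gt0 => /andP[].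
apply: (IHl d') => //.
- by apply: leq_trans le_dl; rewrite d'E ltn_Pmulr // prime_gt1.
- by apply: dvdn_trans dD; rewrite d'E dvdn_mulr.
have [k0 k0E] := div_p _ _ h0 pdiv0; have [k1 k1E] := div_p _ _ h1 pdiv1.
have [k2 k2E] := div_p _ _ h2 pdiv2; have [k3 k3E] := div_p _ _ h3 pdiv3.
by exists k0, k1, k2, k3.
Qed.

End Lattice.

Arguments lat_elem : clear implicits.
Arguments lattice : clear implicits.

(** * Intersection of two lattices and its index *)

Section LatticePair.
Variables (m t e t' e' K : int) (N : nat).
Hypotheses (K0 : K != 0) (N_gt0 : (0 < N)%N).
Hypothesis same : forall k : int,
  [&& (K %| k * (t - t'))%Z, (K %| k * (e - e'))%Z & (K %| k * (t * e - t' * e'))%Z]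
  = (N %| k)%Z.

(** The lattices share 1, omega and j, and their fourth vectors differ by ((e - e') omega - (t - t')
    j - (t e - t' e'))/K. The hypothesis [same] says that exactly the multiples of [N] make [k]
    times this integral. *)
Lemma lattice_meet (c0 c1 c2 k : int) :
  lattice m t' e' K (lat_elem m t e K c0%:~R c1%:~R c2%:~R k%:~R) <-> (N %| k)%Z.
Proof.
have K0' : K%:~R != 0 :> rat by rewrite intr_eq0.
split=> [[d0 [d1 [d2 [d3 cd]]]]|].
  have hk := congr1 (@q_k _ _ _) cd; have hj := congr1 (@q_j _ _ _) cd.
  have hi := congr1 (@q_i _ _ _) cd; have h1 := congr1 (@q_1 _ _ _) cd.
  have kE : k = d3.
    apply/eqP; rewrite -(eqr_int rat); apply/eqP.
    transitivity (2%:R * K%:~R * (k%:~R / (2%:R * K%:~R)) : rat); first by field.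
    by move: hk => /= ->; field.
  rewrite -same; apply/and3P; split; apply/dvdzP.
  - exists (c2 - d2); apply/eqP; rewrite -(eqr_int rat); apply/eqP.
    rewrite !(rmorphM, rmorphB) /=.
    transitivity (K%:~R * (c2%:~R + k%:~R * (1 / 2%:R - t'%:~R) / K%:~R
      - (c2%:~R + k%:~R * (1 / 2%:R - t%:~R) / K%:~R)) : rat); first by field.
    by move: hj => /= ->; rewrite kE; field.
  - exists (d1 - c1); apply/eqP; rewrite -(eqr_int rat); apply/eqP.
    rewrite !(rmorphM, rmorphB) /=.
    transitivity (2%:R * K%:~R * ((c1%:~R / 2%:R + k%:~R * e%:~R / (2%:R * K%:~R))
      - (c1%:~R / 2%:R + k%:~R * e'%:~R / (2%:R * K%:~R))) : rat); first by field.
    by move: hi => /= ->; rewrite kE; field.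
  have hi1 : c0%:~R - k%:~R * (t%:~R * e%:~R) / K%:~R =
             d0%:~R - k%:~R * (t'%:~R * e'%:~R) / K%:~R :> rat.
    transitivity (q_1 (lat_elem m t e K c0%:~R c1%:~R c2%:~R k%:~R)
      - q_i (lat_elem m t e K c0%:~R c1%:~R c2%:~R k%:~R)).
      by rewrite /=; field.
    by rewrite h1 hi kE /=; field.
  exists (c0 - d0); apply/eqP; rewrite -(eqr_int rat); apply/eqP.
  rewrite !(rmorphM, rmorphB) /=.
  transitivity (K%:~R * (c0%:~R - (c0%:~R - k%:~R * (t%:~R * e%:~R) / K%:~R))
    - k%:~R * (t'%:~R * e'%:~R) : rat); first by field.
  by rewrite hi1; field.
rewrite -same => /and3P[/dvdzP[q2 h2] /dvdzP[q1 h1] /dvdzP[q0 h0]].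
exists (c0 - q0), (c1 + q1), (c2 - q2), k.
have h2Q : k%:~R * (t%:~R - t'%:~R) = q2%:~R * K%:~R :> rat by rewrite -rmorphB -!rmorphM /= h2.
have h1Q : k%:~R * (e%:~R - e'%:~R) = q1%:~R * K%:~R :> rat by rewrite -rmorphB -!rmorphM /= h1.
have h0Q : k%:~R * (t%:~R * e%:~R - t'%:~R * e'%:~R) = q0%:~R * K%:~R :> rat.
  by rewrite -!rmorphM -rmorphB -!rmorphM /= h0.
have q2E : q2%:~R = k%:~R * (t%:~R - t'%:~R) / K%:~R :> rat by rewrite h2Q mulfK.
have q1E : q1%:~R = k%:~R * (e%:~R - e'%:~R) / K%:~R :> rat by rewrite h1Q mulfK.
have q0E : q0%:~R = k%:~R * (t%:~R * e%:~R - t'%:~R * e'%:~R) / K%:~R :> rat by rewrite h0Q mulfK.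
by apply: quatP; rewrite /= ?rmorphB ?rmorphD /= ?q0E ?q1E ?q2E; field.
Qed.

Lemma lattice_index : has_index (lattice m t e K `&` lattice m t' e' K) (lattice m t e K) N.
Proof.
(* The coset representatives are the first [N] multiples of the fourth basis vector. *)
exists (fun i : 'I_N => lat_elem m t e K 0%:~R 0%:~R 0%:~R (i : nat)%:Z%:~R); split.
  by move=> i; exists 0, 0, 0, (i : nat)%:Z.
move=> x [c0 [c1 [c2 [c3 ->]]]].
have meetP (i : 'I_N) : (lattice m t e K `&` lattice m t' e' K)%classic
    (lat_elem m t e K c0%:~R c1%:~R c2%:~R c3%:~R
      - lat_elem m t e K 0%:~R 0%:~R 0%:~R (i : nat)%:Z%:~R)
    <-> (N %| c3 - (i : nat)%:Z)%Z.
  rewrite lat_elemB -!rmorphB /=; split=> [[_ /lattice_meet //]|h].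
  by split; [exists (c0 - 0), (c1 - 0), (c2 - 0), (c3 - (i : nat)%:Z) | exact/lattice_meet].
have NZ : N%:Z != 0 by rewrite -lt0n.
have r_lt : (`|(c3 %% N)%Z| < N)%N.
  by rewrite -ltz_nat gez0_abs ?modz_ge0 // ltz_pmod.
exists (Ordinal r_lt); split.
  by apply/meetP; rewrite /= gez0_abs ?modz_ge0 // -eqz_mod_dvd modz_mod.
move=> i /meetP hi; apply: val_inj => /=; apply/eqP; rewrite -eqz_nat gez0_abs ?modz_ge0 //.
move: hi; rewrite -eqz_mod_dvd => /eqP ->.
by rewrite modz_small //= ltz_nat ltn_ord.
Qed.

End LatticePair.

(** * Existence *)

(** Roots modulo the primes of [n], with 2 as the root modulo 3, are glued by the Chinese remainder
    theorem; square-freeness makes each prime coprime to its cofactor. *)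
Lemma exists_norm_root (n : nat) : (0 < n)%N -> square_free n ->
  (forall p, prime p -> (p %| n)%N -> p = 3%N \/ p = 1 %[mod 3]) ->
  exists t : int, (n %| t ^+ 2 - t + 1)%Z.
Proof.
have [l] := ubnP n; elim: l n => // l IHl n; rewrite ltnS => le_nl n_gt0 sqf n_pr.
have [->|n1] := eqVneq n 1%N; first by exists 0; exact: dvd1z.
have n_gt1 : (1 < n)%N by lia.
pose p := pdiv n; have p_pr : prime p by exact: pdiv_prime.
have pn : (p %| n)%N by exact: pdiv_dvd.
have [t tP] : exists t : int, (p %| t ^+ 2 - t + 1)%Z.
  have [->|p1] := n_pr p p_pr pn; first by exists 2.
  by apply: mod3_1_root p_pr _; rewrite p1.
have /dvdnP[n' nE] := pn.
have n'n : (n' %| n)%N by rewrite nE dvdn_mulr.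
have [t' t'P] : exists t : int, (n' %| t ^+ 2 - t + 1)%Z.
  apply: IHl.
  - apply: leq_trans le_nl; rewrite nE ltn_Pmulr ?prime_gt1 //.
    by move: n_gt0; rewrite nE muln_gt0 => /andP[].
  - by move: n_gt0; rewrite nE muln_gt0 => /andP[].
  - exact: square_free_dvdn n'n sqf.
  - by move=> q q_pr qn'; apply: n_pr => //; apply: dvdn_trans n'n.
have co : coprimez p n'.
  rewrite coprimezE /= prime_coprime //; apply: contra (sqf p p_pr) => pn'.
  by rewrite nE expnSr dvdn_mul.
exists (zchinese p n' t t').
have transfer (d T s : int) : (T = s %[mod d])%Z ->
    (d %| s ^+ 2 - s + 1)%Z -> (d %| T ^+ 2 - T + 1)%Z.
  move=> /eqP; rewrite eqz_mod_dvd => dTs ds.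
  rewrite (_ : _ + 1 = (T - s) * (T + s - 1) + (s ^+ 2 - s + 1)); last by ring.
  by rewrite rpredD ?dvdz_mulr.
rewrite nE PoszM mulrC Gauss_dvdz //; apply/andP; split.
  by apply: transfer tP; exact: zchinese_modl.
by apply: transfer t'P; exact: zchinese_modr.
Qed.

Lemma prod_mod3_2 (s : seq nat) : {in s, forall p, p %% 3 = 2}%N ->
  ((\prod_(p <- s) p) %% 3 = if odd (size s) then 2 else 1)%N.
Proof.
elim: s => [|p s IHs] sP; first by rewrite big_nil.
have p2 : (p %% 3 = 2)%N by apply: sP; rewrite mem_head.
have s2 := IHs (fun q qs => sP q (mem_behead (qs : q \in behead (p :: s)))).
by rewrite big_cons -modnMm p2 s2 /=; case: odd.
Qed.

Lemma prod_mod3_1 (s : seq nat) : {in s, forall p, p %% 3 = 1}%N ->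
  ((\prod_(p <- s) p) %% 3 = 1)%N.
Proof.
elim: s => [|p s IHs] sP; first by rewrite big_nil.
have p1 : (p %% 3 = 1)%N by apply: sP; rewrite mem_head.
have s1 := IHs (fun q qs => sP q (mem_behead (qs : q \in behead (p :: s)))).
by rewrite big_cons -modnMm p1 s1.
Qed.

Lemma square_free_prod (n : nat) : (0 < n)%N -> square_free n ->
  n = (\prod_(p <- primes n) p)%N.
Proof.
move=> n_gt0 sqf; rewrite {1}[n]prod_prime_decomp // prime_decompE big_map /=.
apply: eq_big_seq => p; rewrite mem_primes => /and3P[p_pr _ pn].
by rewrite square_free_logn // expn1.
Qed.

Lemma strongly_anisotropic_inert (p m : nat) : prime p -> (p %% 3 = 2)%N ->
  (p %| m)%N -> ~~ (p ^ 2 %| m)%N -> strongly_anisotropic p m.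
Proof.
move=> p_pr p2 pm ppm a b c d; exact: quaternary_inert_dvd.
Qed.

Lemma strongly_anisotropic_3 (m : nat) : (m %% 3 = 1)%N -> strongly_anisotropic 3 m.
Proof.
move=> m1 a b c d; apply: quaternary_3_dvd.
by rewrite -eqz_mod_dvd modz_nat m1.
Qed.

(** * The algebra (-3, -m) and its Eichler orders *)

Section Standard.
Variables (R : realType) (D m : nat).
Hypotheses (m_gt0 : (0 < m)%N).
Local Notation alpha := (- 3%:R : rat).
Local Notation beta := (- (m%:Z)%:~R : rat).

Lemma standard_definite : definite R alpha beta.
Proof.
rewrite /definite !rmorphN rmorph_nat rmorph_int -pmulrn.
apply: anisotropic_division => x; rewrite /nrd => n0.
have mR : 0 < m%:R :> R by rewrite ltr0n.
have : q_1 x ^+ 2 + 3%:R * q_i x ^+ 2 + m%:R * q_j x ^+ 2 + 3%:R * (m%:R * q_k x ^+ 2) = 0.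
  by rewrite -n0; ring.
have g0 (k y : R) : 0 < k -> 0 <= k * y ^+ 2 by move=> k0; rewrite mulr_ge0 ?sqr_ge0 // ltW.
have z0 (k y : R) : 0 < k -> k * y ^+ 2 = 0 -> y = 0.
  by move=> k0 /eqP; rewrite mulf_eq0 gt_eqF //= expf_eq0 => /eqP.
move: (sqr_ge0 (q_1 x)) (g0 3%:R (q_i x) (ltr0Sn _ _)) (g0 _ (q_j x) mR) (g0 _ (q_k x) mR).
move=> h1 h2 h3 h4 h.
apply: quatP => /=.
- by apply: (z0 1) => //; rewrite mul1r; lra.
- by apply: (z0 3%:R) => //; lra.
- by apply: (z0 _ _ mR); lra.
- by apply: (z0 _ _ mR); lra.
Qed.

Hypotheses (D_gt0 : (0 < D)%N) (D_sqf : square_free D).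
Hypothesis D_aniso : forall p, prime p -> (p %| D)%N -> strongly_anisotropic p m.

Lemma standard_discriminant :
  (forall p, prime p -> ~~ (p %| D)%N ->
     [\/ p != 3%N /\ ~~ (p %| m%:Z)%Z, (p %% 3 = 1)%N | p = 3%N /\ (3 %| m%:Z + 1)%Z]) ->
  has_discriminant alpha beta D.
Proof.
move=> D_split; exists (primes D); split; [exact: primes_uniq | | exact: square_free_prod].
move=> p; rewrite mem_primes D_gt0 /=; split=> [/andP[p_pr pD]|[p_pr divp]].
  by exists p_pr; apply: padic_division; exact: D_aniso.
rewrite p_pr; apply: contraT => /(D_split p p_pr) /(padic_norm_rep p_pr)[x [y xy]].
have F0 := padic_pchar p_pr.
exfalso; move: divp.
apply: (@quat_ext_split _ F0 _ _ (Quat _ _ 0 1 0 0) (Quat _ _ 0 0 1 0) (m%:Z)%:~R x y).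
- by rewrite quat_natE expr2; apply: quatP => /=; ring.
- by rewrite expr2; apply: quatP => /=; ring.
- by apply: quatP => /=; ring.
- by rewrite intr_eq0 -lt0n.
- by rewrite rmorph_int.
Qed.

Variables (N : nat) (t e sigma K : int).
Hypotheses (N_gt0 : (0 < N)%N) (K0 : K != 0) (sigma2 : sigma ^+ 2 = 1).
Hypotheses (Kt : (K %| t ^+ 2 - t + 1)%Z) (Ke : (K %| e ^+ 2 + m%:Z)%Z).
Hypotheses (Ket : (K %| e * (2 * t - 1))%Z) (Ket' : (K %| e * (2 - t))%Z).
Hypotheses (DK : D%:Z * K = 3 * m%:Z) (coDK : coprimez D K).
Hypothesis same : forall k : int,
  [&& (K %| k * (t - (1 - t)))%Z, (K %| k * (e - sigma * e))%Z
    & (K %| k * (t * e - (1 - t) * (sigma * e)))%Z] = (N %| k)%Z.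

(** The order is the intersection of M(t, e) and M(1 - t, sigma e), where 1 - t is the conjugate
    root of X^2 - X + 1 modulo [K]. *)
Lemma standard_eichler :
  exists O : set (quat alpha beta),
    [/\ eichler_order O N, O (2%:R^-1 *: (1 + Quat _ _ 0 1 0 0)),
        O (Quat _ _ 0 0 1 0) & O (Quat _ _ 0 0 0 1)].
Proof.
have max (s f : int) : (K %| s ^+ 2 - s + 1)%Z -> (K %| f ^+ 2 + m%:Z)%Z ->
    (K %| f * (2 * s - 1))%Z -> (K %| f * (2 - s))%Z ->
    maximal_order (lattice m s f K).
  move=> /dvdzP[A AE] /dvdzP[E EE] /dvdzP[F FE] /dvdzP[G GE].
  by apply: (@lattice_maximal m s f K K0 A E F G _ _ _ _ D) => //; rewrite mulrC.
have gens (s f : int) : [/\ lattice m s f K (2%:R^-1 *: (1 + Quat _ _ 0 1 0 0)),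
    lattice m s f K (Quat _ _ 0 0 1 0) & lattice m s f K (Quat _ _ 0 0 0 1)].
  have KQ : K%:~R != 0 :> rat by rewrite intr_eq0.
  split.
  - by exists 0, 1, 0, 0; apply: quatP => /=; field.
  - by exists 0, 0, 1, 0; apply: quatP => /=; field.
  (* Here i j = (2 omega - 1) j, and omega j is [K] times the fourth basis vector plus s j - f omega
     + s f. *)
  - exists (2 * s * f), (- 2 * f), (2 * s - 1), (2 * K).
    by rewrite !(rmorphD, rmorphN, rmorphM) /=; apply: quatP => /=; field.
have max1 := max t e Kt Ke Ket Ket'.
have max2 : maximal_order (lattice m (1 - t) (sigma * e) K).
  apply: max.
  - by rewrite (_ : _ + 1 = t ^+ 2 - t + 1) //; ring.
  - by rewrite exprMn sigma2 mul1r.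
  - rewrite (_ : sigma * e * _ = - sigma * (e * (2 * t - 1))); last by ring.
    exact: dvdz_mull.
  - rewrite (_ : sigma * e * _ = sigma * (e * (2 * t - 1) + e * (2 - t))); last by ring.
    by apply: dvdz_mull; rewrite rpredD.
exists (lattice m t e K `&` lattice m (1 - t) (sigma * e) K)%classic.
have [g1 g2 g3] := gens t e; have [h1 h2 h3] := gens (1 - t) (sigma * e).
split=> //.
exists (lattice m t e K), (lattice m (1 - t) (sigma * e) K); split=> //.
  exact: lattice_index.
rewrite setIC; apply: lattice_index => // k; rewrite -same.
have opp (x y : int) : (K %| k * (y - x))%Z = (K %| k * (x - y))%Z.
  by rewrite -opprB mulrN rpredN.
by rewrite (opp t) (opp e) (opp (t * e)).
Qed.

End Standard.

(** The identity 3 = 4 (t^2 - t + 1) - (2t - 1)^2 makes 2t - 1 invertible modulo [n]. *)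
Lemma norm_root_cancel (n : nat) (t k : int) : coprime n 3 ->
  (n %| t ^+ 2 - t + 1)%Z -> (n %| k * (2%:R * t - 1))%Z -> (n %| k)%Z.
Proof.
move=> n3 nt nk; have co : coprimez n 3 by [].
rewrite -(Gauss_dvdzl _ co).
rewrite (_ : k * 3 = 4%:R * k * (t ^+ 2 - t + 1) - k * (2%:R * t - 1) * (2%:R * t - 1));
  last by ring.
by rewrite rpredB //; [exact: dvdz_mull | exact: dvdz_mulr].
Qed.

Lemma norm_root3 (t : int) : (3 %| t ^+ 2 - t + 1)%Z ->
  (3 %| 2%:R * t - 1)%Z /\ (3 %| 2%:R - t)%Z.
Proof.
move=> t3; have h : (3%N %| 2%:R * t - 1)%Z.
  rewrite -dvdz_prime_exp2 // (_ : _ ^+ 2 = 4%:R * (t ^+ 2 - t + 1) - 1 * 3); last by ring.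
  by rewrite rpredB ?dvdz_mull.
split=> //; rewrite (_ : _ - t = t * 3 - 2%:R * (2%:R * t - 1)); last by ring.
by rewrite rpredB ?dvdz_mull.
Qed.

Section Existence.
Variable R : realType.
Local Notation alpha := (- 3%:R : rat).

(** The order is to contain both j and i j, with squares -m and -3m, so that one construction serves
    both admissible values in the theorem. *)
Definition realised (D N m : nat) (b : rat) : Prop :=
  [/\ definite R alpha b, has_discriminant alpha b D
    & exists O : set (quat alpha b),
        [/\ eichler_order O N, O (2%:R^-1 *: (1 + Quat _ _ 0 1 0 0)),
          O (Quat _ _ 0 0 1 0) & O (Quat _ _ 0 0 0 1)]] /\ b = - (m%:Z)%:~R.

(** * Discriminant prime to 3 *)

Section Coprime3.
Variables (D N : nat).
Hypotheses (D_gt0 : (0 < D)%N) (N_gt0 : (0 < N)%N) (coDN : coprime D N).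
Hypotheses (D_sqf : square_free D) (N_sqf : square_free N) (D_odd : odd (size (primes D))).
Hypotheses (D_pr : forall p, prime p -> (p %| D)%N -> (p %% 3 = 2)%N).
Hypotheses (N_pr : forall q, prime q -> (q %| N)%N -> (q %% 3 = 1)%N).

Let D2 : (D %% 3 = 2)%N.
Proof.
rewrite (square_free_prod D_gt0 D_sqf) prod_mod3_2 ?D_odd // => p.
by rewrite mem_primes => /and3P[p_pr _ pD]; exact: D_pr.
Qed.

Let N1 : (N %% 3 = 1)%N.
Proof.
rewrite (square_free_prod N_gt0 N_sqf) prod_mod3_1 // => p.
by rewrite mem_primes => /and3P[p_pr _ pD]; exact: N_pr.
Qed.

(** The parity of the number of primes gives [D * N] = -1 modulo 3, so the algebra splits at 3. For
    both levels K = 3N: M(t, e) and M(1 - t, e) agree at 3 and meet in index N, while M(1 - t, -e)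
    differs from M(t, e) at 3 as well, giving index 3N. *)
Lemma realised_coprime3 :
  realised D N (D * N) (- ((D * N)%N%:Z)%:~R) /\
  realised D (3 * N) (D * N) (- ((D * N)%N%:Z)%:~R).
Proof.
have DN_gt0 : (0 < D * N)%N by rewrite muln_gt0 D_gt0.
have N3 : (3 %| N%:Z - 1)%Z by rewrite -eqz_mod_dvd modz_nat N1.
have D3 : (3 %| D%:Z + 1)%Z.
  by have : (3 %| D + 1)%N by rewrite /dvdn -modnDml D2.
have coN3 : coprime N 3 by rewrite coprime_sym prime_coprime // /dvdn N1.
have coD3 : coprime D 3 by rewrite coprime_sym prime_coprime // /dvdn D2.
have DN_sqf := square_free_mul coDN D_sqf N_sqf.
have [t tP] : exists t : int, ((3 * N)%N %| t ^+ 2 - t + 1)%Z.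
  apply: exists_norm_root; first by rewrite muln_gt0.
    apply: square_free_mul => //; first by rewrite coprime_sym.
    by move=> p p_pr; have := prime_gt1 p_pr; apply: contraTN => /(dvdn_leq (isT : 0 < 3)%N); nia.
  move=> p p_pr; rewrite Euclid_dvdM // => /orP[|/(N_pr p_pr) ->]; last by right.
  by rewrite dvdn_prime2 // => /eqP->; left.
have tN : (N%:Z %| t ^+ 2 - t + 1)%Z by apply: dvdz_trans tP; rewrite PoszM dvdz_mull.
have [t3 t3'] : (3 %| 2%:R * t - 1)%Z /\ (3 %| 2%:R - t)%Z.
  by apply: norm_root3; apply: dvdz_trans tP; rewrite PoszM dvdz_mulr.
(* [e] must vanish modulo [N] and satisfy e^2 = -DN modulo 3; since D = 2 and N = 1 modulo 3, N^2
   does both. *)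
pose e : int := N%:Z ^+ 2.
have eN : (N%:Z %| e)%Z by rewrite /e expr2 dvdz_mulr.
have KE : (3 * N)%N%:Z = N%:Z * 3 by rewrite PoszM mulrC.
have Ke : ((3 * N)%N%:Z %| e ^+ 2 + (D * N)%N%:Z)%Z.
  rewrite KE PoszM (_ : _ + _ = N%:Z * ((N%:Z - 1) * (N%:Z ^+ 2 + N%:Z + 1) + (D%:Z + 1)));
    last by rewrite /e; ring.
  by apply: dvdz_mul => //; rewrite rpredD // dvdz_mulr.
have Ket : ((3 * N)%N%:Z %| e * (2%:R * t - 1))%Z by rewrite KE; apply: dvdz_mul.
have Ket' : ((3 * N)%N%:Z %| e * (2%:R - t))%Z by rewrite KE; apply: dvdz_mul.
have K0 : (3 * N)%N%:Z != 0 by rewrite -lt0n muln_gt0.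
have DK : D%:Z * (3 * N)%N%:Z = 3 * (D * N)%N%:Z by rewrite !PoszM; ring.
have coDK : coprimez D (3 * N)%N by rewrite coprimezE /= coprimeMr coD3.
have aniso p : prime p -> (p %| D)%N -> strongly_anisotropic p (D * N)%N.
  move=> p_pr pD; apply: strongly_anisotropic_inert => //; first exact: D_pr.
    by rewrite dvdn_mulr.
  exact: DN_sqf.
have def := @standard_definite R (D * N) DN_gt0.
have disc : has_discriminant alpha (- ((D * N)%N%:Z)%:~R) D.
  apply: standard_discriminant => // p p_pr pD.
  have [->|p3] := eqVneq p 3%N.
    apply: Or33; split=> //; rewrite PoszM.
    rewrite (_ : _ + 1 = N%:Z * (D%:Z + 1) - (N%:Z - 1)); last by ring.
    by rewrite rpredB ?dvdz_mull.
  have [pN|pN] := boolP (p %| N)%N; first by apply: Or32; exact: N_pr.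
  by apply: Or31; split=> //; rewrite dvdzE /= Euclid_dvdM // negb_or pD.
have twice (k : int) : k * (t - (1 - t)) = k * (2%:R * t - 1) by ring.
split; split=> //; split=> //.
  apply: (@standard_eichler D (D * N) D_gt0 aniso N t e 1 (3 * N)%N) => //.
  move=> k; apply/and3P/idP => [[+ _ _]|kN]; rewrite twice.
    by move=> h; apply: norm_root_cancel coN3 tN _; apply: dvdz_trans h; rewrite KE dvdz_mulr.
  split; first by rewrite KE; apply: dvdz_mul.
    by rewrite mul1r subrr mulr0 dvdz0.
  rewrite (_ : _ * _ = k * (e * (2%:R * t - 1))); last by ring.
  exact: dvdz_mull.
apply: (@standard_eichler D (D * N) D_gt0 aniso (3 * N) t e (-1) (3 * N)%N) => //.
  by rewrite muln_gt0.
move=> k; apply/and3P/idP => [[+ _ +]|kN]; last by split; apply: dvdz_mulr.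
rewrite twice (_ : k * (t * e - _) = k * e); last by ring.
move=> h1 h2; rewrite KE Gauss_dvdz; last by rewrite coprimezE.
apply/andP; split.
  by apply: norm_root_cancel coN3 tN _; apply: dvdz_trans h1; rewrite KE dvdz_mulr.
have co3N : coprimez 3 (N%:Z ^+ 2) by rewrite coprimezXr // coprimezE coprime_sym.
by rewrite -(Gauss_dvdzl _ co3N); apply: dvdz_trans h2; rewrite KE dvdz_mull.
Qed.

End Coprime3.

(** * Discriminant divisible by 3 *)

Section Ramified3.
Variables (D N : nat).
Hypotheses (D_gt0 : (0 < D)%N) (N_gt0 : (0 < N)%N) (coDN : coprime (3 * D) N).
Hypotheses (D_sqf : square_free (3 * D)) (N_sqf : square_free N).
Hypotheses (D_odd : odd (size (primes (3 * D)))).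
Hypotheses (D_pr : forall p, prime p -> (p %| 3 * D)%N -> p = 3%N \/ (p %% 3 = 2)%N).
Hypotheses (N_pr : forall q, prime q -> (q %| N)%N -> (q %% 3 = 1)%N).

Let coD3 : ~~ (3 %| D)%N.
Proof. by have := D_sqf (isT : prime 3); apply: contra => h; rewrite expnS dvdn_mul. Qed.

Let D_sqf' : square_free D.
Proof. by apply: square_free_dvdn D_sqf; rewrite dvdn_mull. Qed.

Let D1 : (D %% 3 = 1)%N.
Proof.
have even_D : ~~ odd (size (primes D)).
  move: D_odd; have D3_gt0 : (0 < 3 * D)%N by rewrite muln_gt0.
  suff -> : size (primes (3 * D)) = (size (primes D)).+1 by [].
  rewrite -[RHS]/(size (3%N :: primes D)); apply: perm_size; apply: uniq_perm.
  - exact: primes_uniq.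
  - by rewrite /= primes_uniq mem_primes (negPf coD3) !andbF.
  by move=> p; rewrite primesM // primes_prime // !inE.
rewrite (square_free_prod D_gt0 D_sqf') prod_mod3_2 ?(negPf even_D) // => p.
rewrite mem_primes => /and3P[p_pr _ pD].
have [p3|//] := D_pr p_pr (dvdn_mull 3 pD); by move: pD; rewrite p3 (negPf coD3).
Qed.

Let N1 : (N %% 3 = 1)%N.
Proof.
rewrite (square_free_prod N_gt0 N_sqf) prod_mod3_1 // => p.
by rewrite mem_primes => /and3P[p_pr _ pD]; exact: N_pr.
Qed.

(** [D] is the discriminant without its factor 3, a product of an even number of primes, so [D * N]
    = 1 modulo 3 and the algebra ramifies at 3. Now K = N and e = 0 suffice, and the roots t and 1 -
    t alone separate the two lattices. *)
Lemma realised_ramified3 : realised (3 * D) N (D * N) (- ((D * N)%N%:Z)%:~R).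
Proof.
have DN_gt0 : (0 < D * N)%N by rewrite muln_gt0 D_gt0.
have D3_gt0 : (0 < 3 * D)%N by rewrite muln_gt0.
have coN3 : coprime N 3 by rewrite coprime_sym prime_coprime // /dvdn N1.
have coDN' : coprime D N by apply: coprime_dvdl coDN; rewrite dvdn_mull.
have DN_sqf := square_free_mul coDN' D_sqf' N_sqf.
have [t tN] : exists t : int, (N %| t ^+ 2 - t + 1)%Z.
  by apply: exists_norm_root => // p p_pr /(N_pr p_pr) ->; right.
have aniso p : prime p -> (p %| 3 * D)%N -> strongly_anisotropic p (D * N)%N.
  move=> p_pr pD; have [p3|p3] := eqVneq p 3%N.
    by rewrite p3; apply: strongly_anisotropic_3; rewrite -modnMm D1 N1.
  apply: strongly_anisotropic_inert => //.
  - by have [p3'|//] := D_pr p_pr pD; rewrite p3' in p3.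
  - by move: pD; rewrite Euclid_dvdM // dvdn_prime2 // (negPf p3) => /= /dvdn_mulr->.
  - exact: DN_sqf.
split=> //; split; first exact: standard_definite.
  apply: standard_discriminant => // p p_pr; rewrite Euclid_dvdM // negb_or => /andP[p3 pD].
  have [pN|pN] := boolP (p %| N)%N; first by apply: Or32; exact: N_pr.
  apply: Or31; split; first by move: p3; rewrite dvdn_prime2.
  by rewrite dvdzE /= Euclid_dvdM // negb_or pD.
apply: (@standard_eichler (3 * D) (D * N) D3_gt0 aniso N t 0 1 N%:Z) => //.
- by rewrite -lt0n.
- by rewrite expr0n add0r PoszM dvdz_mull.
- by rewrite mul0r.
- by rewrite mul0r.
- by rewrite !PoszM; ring.
move=> k; rewrite !(mulr0, subrr, dvdz0, andbT).
rewrite (_ : k * _ = k * (2%:R * t - 1)); last by ring.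
by apply/idP/idP => [|kN]; [exact: norm_root_cancel | exact: dvdz_mulr].
Qed.

End Ramified3.

Lemma realised_embedding (D N m m0 : nat) (b : rat) : (0 < m)%N ->
  realised D N m b -> m0 = m \/ m0 = (3 * m)%N ->
  exists a b : rat, [/\ a != 0, b != 0, definite R a b,
      has_discriminant a b D
    & exists (O : set (quat a b)) (w1 w2 : quat a b),
        [/\ eichler_order O N, w1 ^+ 2 = - 3%:R, w2 ^+ 2 = - m0%:R,
            O (2%:R^-1 *: (1 + w1)) & O w2]].
Proof.
move=> m_gt0 [[def disc [O [eO O1 O2 O3]]] bE] m0E; exists alpha, b.
split=> //; first by rewrite bE oppr_eq0 intr_eq0 -lt0n.
have i2 : Quat alpha b 0 1 0 0 ^+ 2 = - 3%:R.
  by rewrite quat_natE expr2; apply: quatP => /=; ring.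
case: m0E => ->.
  exists O, (Quat _ _ 0 1 0 0), (Quat _ _ 0 0 1 0); split=> //.
  by rewrite quat_natE expr2; apply: quatP; rewrite /= ?bE -?pmulrn; ring.
exists O, (Quat _ _ 0 1 0 0), (Quat _ _ 0 0 0 1); split=> //.
by rewrite quat_natE expr2 natrM; apply: quatP; rewrite /= ?bE -?pmulrn; ring.
Qed.

End Existence.

Theorem theorem1p34 (R : realType) (D N m : nat)
  (D_gt0 : (0 < D)%N) (N_gt0 : (0 < N)%N) (coDN : coprime D N)
  (D_sqf : square_free D) (N_sqf : square_free N)
  (D_odd : odd (size (primes D)))
  (m_dvd : (m %| D * N)%N) (m_gt1 : (1 < m)%N) (m_neq3 : m <> 3%N) :
  (exists a b : rat, [/\ a != 0, b != 0, definite R a b,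
      has_discriminant a b D
    & exists (O : set (quat a b)) (w1 w2 : quat a b),
        [/\ eichler_order O N, w1 ^+ 2 = - 3%:R, w2 ^+ 2 = - m%:R,
            O (2%:R^-1 *: (1 + w1)) & O w2]])
  <->
  [/\ m = (D * N)%N \/ ((3 %| D * N)%N /\ m = (D * N %/ 3)%N),
      forall p : nat, prime p -> (p %| D)%N -> p = 3%N \/ p = 2 %[mod 3]
    & forall q : nat, prime q -> (q %| N)%N -> q = 3%N \/ q = 1 %[mod 3]].
Proof.
split=> [[a [b [_ _ def disc [O [w1 [w2
    [[M1 [M2 [[ordM1 _] [ordM2 _] OE idx1 _]]] w11 w22 Oo Ow]]]]]]]|].
  have subO : GRing.subring_closed [in O].
    case: ordM1 => sub1 _ _; case: ordM2 => sub2 _ _; rewrite OE; split.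
    - by apply: mem_set; split; [exact: (subring_set1 sub1) | exact: (subring_set1 sub2)].
    - move=> x y /set_mem[x1 x2] /set_mem[y1 y2]; apply: mem_set.
      by split; [exact: (subring_setB sub1) | exact: (subring_setB sub2)].
    - move=> x y /set_mem[x1 x2] /set_mem[y1 y2]; apply: mem_set.
      by split; [exact: (subring_setM sub1) | exact: (subring_setM sub2)].
  have OM : (O `<=` M1)%classic by rewrite OE => x [].
  by apply: (necessity D_gt0 N_gt0 coDN D_sqf N_sqf D_odd m_dvd m_gt1 m_neq3
    def disc ordM1 subO OM idx1 w11 w22 Oo Ow).
move=> [mE D_pr N_pr].
have not3 p k n : prime p -> ~~ (3 %| n)%N -> (p %| n)%N -> p = 3%N \/ p = k %[mod 3] ->
    (p %% 3 = k %% 3)%N.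
  by move=> _ n3 pn [p3|//]; move: n3; rewrite -p3 pn.
(* The construction uses the part of [D * N] prime to 3, here [D' * N], [D * N'] or [D * N]. In the
   first two cases [m] is this part or 3 times it, realised by j or i j; in the last one only
   [m = D * N] is possible. *)
have [D3|D3] := boolP (3 %| D)%N.
  have [D' DE] := dvdnP D3; rewrite mulnC in DE.
  have N3 : ~~ (3 %| N)%N.
    by move: coDN; rewrite DE coprimeMl prime_coprime // => /andP[].
  rewrite {}DE in D_gt0 coDN D_sqf D_odd D_pr mE *.
  have D'_gt0 : (0 < D')%N by move: D_gt0; rewrite muln_gt0 => /andP[].
  have real := @realised_ramified3 R D' N D'_gt0 N_gt0 coDN D_sqf N_sqf D_odd D_pr
    (fun q q_pr qN => not3 q 1%N N q_pr N3 qN (N_pr q q_pr qN)).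
  apply: (realised_embedding _ real); first by rewrite muln_gt0 D'_gt0.
  by case: mE => [->|[_ ->]]; [right; rewrite mulnA | left; rewrite -mulnA mulKn].
have D_pr' p (p_pr : prime p) (pD : (p %| D)%N) := not3 p 2%N D p_pr D3 pD (D_pr p p_pr pD).
have [N3|N3] := boolP (3 %| N)%N.
  have [N' NE] := dvdnP N3; rewrite mulnC in NE.
  have N'3 : ~~ (3 %| N')%N.
    by have := N_sqf 3%N isT; apply: contra => h; rewrite NE expnS dvdn_mul.
  have N'N : (N' %| N)%N by rewrite NE dvdn_mull.
  have N'_gt0 : (0 < N')%N by move: N_gt0; rewrite NE muln_gt0 => /andP[].
  have N'_pr q (q_pr : prime q) (qN : (q %| N')%N) :=
    not3 q 1%N N' q_pr N'3 qN (N_pr q q_pr (dvdn_trans qN N'N)).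
  have [_ real] := @realised_coprime3 R D N' D_gt0 N'_gt0 (coprime_dvdr N'N coDN) D_sqf
    (square_free_dvdn N'N N_sqf) D_odd D_pr' N'_pr.
  rewrite -NE in real.
  apply: (realised_embedding _ real); first by rewrite muln_gt0 D_gt0.
  by case: mE => [->|[_ ->]]; rewrite NE mulnCA; [right | left; rewrite mulKn].
have N_pr' q (q_pr : prime q) (qN : (q %| N)%N) := not3 q 1%N N q_pr N3 qN (N_pr q q_pr qN).
have [real _] := @realised_coprime3 R D N D_gt0 N_gt0 coDN D_sqf N_sqf D_odd D_pr' N_pr'.
apply: (realised_embedding _ real); first by rewrite muln_gt0 D_gt0.
case: mE => [->|[]]; first by left.
by rewrite Euclid_dvdM // (negPf D3) (negPf N3).
Qed.
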